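(* Let $\tau\ge0$, let $m_n$ be the median of $L_n^{(\tau)}(\xi)$ and define $$x^*(u,n)=\inf_{s>0}\left\{\frac{\ln n+n\kappa_d\delta_n^d(e^s-1)}{2n\kappa_d\delta_n^ds}+\sqrt{\frac{u^2}{8n^2\kappa_d^2\delta_n^{2d+\tau}(u+m_n)s}+\bigg(\frac{\ln n+n\kappa_d\delta_n^d(e^s-1)}{2n\kappa_d\delta_n^ds}\bigg)^2}\,\right\}.$$ Then, for $u>0$, $$\mathbb{P}(|L_n^{(\tau)}(\xi)-m_n|\ge u)\le8\exp\left(-\frac{u^2}{8n\kappa_d\delta_n^{d+\tau}x^*(u,n)(u+m_n)}\right)$$ and, in particular, $$\mathbb{P}(|L_n^{(\tau)}(\xi)-m_n|\ge u)\le8\exp\left(-\min\bigg\{\frac{u^2}{C_{n,W}(u+m_n)},\frac{u}{D_n\sqrt{u+m_n}}\bigg\}\right)$$ with $C_{n,W}=16\big(\ln(n)\,\delta_n^\tau+2n\kappa_d\delta_n^{d+\tau}\big)$ and $D_n=4\sqrt{2\delta_n^\tau}$.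
   Context: Fix an integer $d\ge1$. $W\subset\mathbb{R}^d$ is a compact convex set of volume one, and $(\delta_n)_{n\in\mathbb{N}}$ is a sequence of positive real numbers with $\delta_n\to0$ as $n\to\infty$. For a fixed integer $n\ge2$, $X_1,\dots,X_n$ are independent random points uniformly distributed in $W$ and $\xi=\{X_1,\dots,X_n\}$. Define $$L_n^{(\tau)}(\xi):=\frac12\sum_{(X_i,X_j)\in\xi^2_{\neq}}\mathbf{1}(\|X_i-X_j\|\le\delta_n)\,\|X_i-X_j\|^\tau,$$ the sum ranging over all ordered pairs of distinct points of $\xi$. $\kappa_d$ is the volume of the $d$-dimensional unit ball. A median $m$ of a random variable $X$ satisfies $\mathbb{P}(X\le m)\ge\frac12$ and $\mathbb{P}(X\ge m)\ge\frac12$. *)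

(* Defs.v *)
From HB Require Import structures.
From mathcomp Require Import all_boot all_order all_algebra.
From mathcomp Require Import all_classical all_reals all_analysis.

Set Implicit Arguments.
Unset Strict Implicit.
Unset Printing Implicit Defensive.

Import Order.TTheory GRing.Theory Num.Theory.
Import numFieldNormedType.Exports.

Local Open Scope classical_set_scope.
Local Open Scope ring_scope.

Definition measure_rV_display : measure_display -> measure_display.
Proof. exact. Qed.

(* The sigma-algebra on R^d is generated by the coordinate maps, as for        *)
(* [d.-tuple R]; it is the Borel sigma-algebra of R^d.                         *)
Section measurable_rV.
Context {R : realType} (d : nat).

Let coord (j : 'I_d) (x : 'rV[R]_d) : measurableTypeR R := x ord0 j.

Let rV_set0 : g_sigma_preimage coord set0.
Proof. exact: sigma_algebra0. Qed.

Let rV_setC A : g_sigma_preimage coord A -> g_sigma_preimage coord (~` A).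
Proof. exact: sigma_algebraC. Qed.

Let rV_bigcup (F : _^nat) : (forall i, g_sigma_preimage coord (F i)) ->
  g_sigma_preimage coord (\bigcup_i (F i)).
Proof. exact: sigma_algebra_bigcup. Qed.

HB.instance Definition _ := @isMeasurable.Build
  (measure_rV_display (R.-ocitv.-measurable).-sigma) 'rV[R]_d
  (g_sigma_preimage coord) rV_set0 rV_setC rV_bigcup.

End measurable_rV.


Section measurable_rV_theory.
Context {R : realType}.

Lemma measurable_coord d (j : 'I_d) :
  measurable_fun [set: 'rV[R]_d] (fun x : 'rV[R]_d => x ord0 j).
Proof.
move=> _ Y mY; rewrite setTI; apply: sub_sigma_algebra => /=.
rewrite -bigcup_seq/=; exists j => /=; first by rewrite mem_index_enum.
by exists Y => //; rewrite setTI.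
Qed.

Lemma measurable_fun_rV d0 (T : measurableType d0) d (f : T -> 'rV[R]_d) :
  (forall j, measurable_fun [set: T] (fun t => f t ord0 j)) ->
  measurable_fun [set: T] f.
Proof.
move=> mf _ Y; pose C := [set A | measurable ([set: T] `&` f @^-1` A)].
suff: measurable `<=` C by exact.
apply: smallest_sub.
  split=> [|A|F]; rewrite /C/=.
  - by rewrite preimage_set0 setI0.
  - by rewrite setTI setTD preimage_setC !setTI; exact: measurableC.
  - move=> mF; rewrite preimage_bigcup setI_bigcupr.
    exact: bigcupT_measurable.
rewrite -bigcup_seq/=; apply: bigcup_sub => j _ _ [A mA <-].
by rewrite /C/= setTI; exact: mf.
Qed.

Definition cons_rV n (p : R * 'rV[R]_n) : 'rV[R]_n.+1 :=
  \row_j (if unlift ord0 j is Some i then p.2 ord0 i else p.1).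

Lemma cons_rV0 n (p : R * 'rV[R]_n) : cons_rV p ord0 ord0 = p.1.
Proof. by rewrite mxE unlift_none. Qed.

Lemma cons_rVS n (p : R * 'rV[R]_n) j : cons_rV p ord0 (lift ord0 j) = p.2 ord0 j.
Proof. by rewrite mxE liftK. Qed.

Lemma measurable_cons_rV n : measurable_fun [set: R * 'rV[R]_n] (@cons_rV n).
Proof.
apply: measurable_fun_rV => j; case: (unliftP ord0 j) => [i|] ->.
- rewrite (_ : (fun _ => _) = (fun x : 'rV[R]_n => x ord0 i) \o snd).
    by apply: measurableT_comp => //; exact: measurable_coord.
  by apply/funext => p /=; rewrite cons_rVS.
- by rewrite (_ : (fun _ => _) = fst)//; apply/funext => p /=; rewrite cons_rV0.
Qed.

End measurable_rV_theory.

(* Lebesgue measure on R^d, as the d-fold product of the one on R.             *)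
Fixpoint lebesgue_rV {R : realType} (d : nat) : set 'rV[R]_d -> \bar R :=
  match d with
  | 0 => @dirac _ 'rV[R]_0 0 R
  | n.+1 => pushforward (product_measure1 lebesgue_measure (@lebesgue_rV R n))
                        (@cons_rV R n)
  end.

Lemma sigma_finite_pushforward_prod d1 d2 d3 (T1 : measurableType d1)
    (T2 : measurableType d2) (T3 : measurableType d3) (R : realType)
    (m1 : {sigma_finite_measure set T1 -> \bar R})
    (m2 : {sigma_finite_measure set T2 -> \bar R})
    (f : T1 * T2 -> T3) (g : T3 -> T1 * T2) :
    measurable_fun setT f -> measurable_fun setT g -> cancel f g ->
  exists nu : {sigma_finite_measure set T3 -> \bar R},
    pushforward (product_measure1 m1 m2) f = nu.
Proof.
move=> mf mg fK.
have /sigma_finiteP[F [FT ndF Foo]] := sigma_finiteT m1.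
have /sigma_finiteP[G [GT ndG Goo]] := sigma_finiteT m2.
pose nuM : {measure set T3 -> \bar R} :=
  measure_function_pushforward__canonical__measure_function_Measure
    (product_measure1 m1 m2) mf.
have sfin : sigma_finite [set: T3] nuM.
  exists (fun i => g @^-1` (F i `*` G i)).
    rewrite -preimage_bigcup (_ : \bigcup_i _ = setT) ?preimage_setT//.
    rewrite -setXTT FT GT predeqE => -[x y]; split.
      by move=> [i _ []/= ? ?]; split; exists i.
    move=> [/= [i _ Fix] [k _ Gky]]; exists (maxn i k) => //; split.
    - by move: x Fix; exact/subsetPset/ndF/leq_maxl.
    - by move: y Gky; exact/subsetPset/ndG/leq_maxr.
  move=> i; have [mF Fi] := Foo i; have [mG Gi] := Goo i; split.
    by rewrite -[X in measurable X]setTI; apply: mg => //; exact: measurableX.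
  rewrite /nuM/= /pushforward -comp_preimage (_ : g \o f = id); last first.
    exact/funext/fK.
  by rewrite preimage_id product_measure1E// lte_mul_pinfty// ge0_fin_numE.
by exists (HB.pack_for {sigma_finite_measure set T3 -> \bar R}
  (Measure.sort nuM) (Measure_isSigmaFinite.Build _ _ _ nuM sfin)).
Qed.

Section lebesgue_rV_measure.
Context {R : realType}.

Let uncons n (x : 'rV[R]_n.+1) : R * 'rV[R]_n :=
  (x ord0 ord0, \row_j x ord0 (lift ord0 j)).

Let cons_rVK n : cancel (@cons_rV R n) (@uncons n).
Proof.
move=> [a x]; rewrite /uncons cons_rV0; congr pair.
by apply/rowP => j; rewrite mxE cons_rVS.
Qed.

Let measurable_uncons n : measurable_fun [set: 'rV[R]_n.+1] (@uncons n).
Proof.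
apply: measurable_fun_pair => /=; first exact: measurable_coord.
apply: measurable_fun_rV => j.
rewrite (_ : (fun _ => _) = fun x : 'rV_n.+1 => x ord0 (lift ord0 j)).
  exact: measurable_coord.
by apply/funext => x; rewrite mxE.
Qed.

Let lebesgue_rVP d : exists mu : {sigma_finite_measure set 'rV[R]_d -> \bar R},
  lebesgue_rV (d := d) = mu.
Proof.
elim: d => [|n [mu muE]]; first by exists (@dirac _ 'rV[R]_0 0 R).
rewrite /= muE.
have := @sigma_finite_pushforward_prod _ _ _ (measurableTypeR R) 'rV[R]_n
  'rV[R]_n.+1 R lebesgue_measure mu (@cons_rV R n) (@uncons n).
apply; [exact: measurable_cons_rV|exact: measurable_uncons|exact: cons_rVK].
Qed.

Variable d : nat.

Let lebesgue_rV0 : lebesgue_rV (set0 : set 'rV[R]_d) = 0%E.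
Proof. by have [mu ->] := lebesgue_rVP d; exact: measure0. Qed.

Let lebesgue_rV_ge0 (A : set 'rV[R]_d) : (0 <= lebesgue_rV A)%E.
Proof. by have [mu ->] := lebesgue_rVP d; exact: measure_ge0. Qed.

Let lebesgue_rV_sigma_additive : semi_sigma_additive (@lebesgue_rV R d).
Proof. by have [mu ->] := lebesgue_rVP d; exact: measure_semi_sigma_additive. Qed.

HB.instance Definition _ := isMeasure.Build _ _ _ (@lebesgue_rV R d)
  lebesgue_rV0 lebesgue_rV_ge0 lebesgue_rV_sigma_additive.

Let lebesgue_rV_sigma_finite : sigma_finite setT (@lebesgue_rV R d).
Proof. by have [mu ->] := lebesgue_rVP d; exact: sigma_finiteT. Qed.

HB.instance Definition _ := Measure_isSigmaFinite.Build _ _ _ (@lebesgue_rV R d)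
  lebesgue_rV_sigma_finite.

End lebesgue_rV_measure.

Section random_geometric_graph.
Context {R : realType}.

(* The library norm on ['rV[R]_d] is the sup norm. *)
Definition enorm d (x : 'rV[R]_d) : R :=
  Num.sqrt (\sum_(j < d) x ord0 j ^+ 2).

Definition kappa (d : nat) : R :=
  fine (lebesgue_rV [set x : 'rV[R]_d | enorm x <= 1]).

(* L^(tau) for the distance threshold delta; [xi] is meant to be finite (on a *)
(* set with infinitely many nonzero terms the finitely supported sum is 0).   *)
Definition edge_length_sum d (tau delta : R) (xi : set 'rV[R]_d) : R :=
  2^-1 * \sum_(p \in [set p : 'rV[R]_d * 'rV[R]_d |
                        [/\ xi p.1, xi p.2 & p.1 <> p.2]])
            ((enorm (p.1 - p.2) <= delta)%R%:R * enorm (p.1 - p.2) `^ tau).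

Definition xstar (d : nat) (tau delta : R) (n : nat) (m u : R) : R :=
  let a s := (ln n%:R + n%:R * kappa d * delta ^+ d * (expR s - 1))
             / (2 * n%:R * kappa d * delta ^+ d * s) in
  inf [set a s + Num.sqrt
         (u ^+ 2 / (8 * n%:R ^+ 2 * kappa d ^+ 2
                    * delta `^ (2 * d%:R + tau) * (u + m) * s)
          + a s ^+ 2)
      | s in [set s : R | 0 < s]].

End random_geometric_graph.

Section probabilistic_notions.
Context d0 (Om : measurableType d0) {R : realType} (P : probability Om R).

Definition is_median (Y : Om -> R) (m : R) : Prop :=
  ((2^-1)%:E <= P [set w | (Y w <= m)%R])%E /\
  ((2^-1)%:E <= P [set w | (m <= Y w)%R])%E.

Definition mutually_independent d1 (T : measurableType d1) (I : finType)
    (X : I -> {RV P >-> T}) : Prop :=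
  forall (J : {set I}) (A : I -> set T), (forall i, measurable (A i)) ->
    P (\bigcap_(i in [set` J]) (X i @^-1` A i)) =
    (\prod_(i in J) P (X i @^-1` A i))%E.

Definition uniformly_distributed d (X : {RV P >-> 'rV[R]_d}) (W : set 'rV[R]_d)
    : Prop :=
  forall B : set 'rV[R]_d, measurable B ->
    P (X @^-1` B) = (lebesgue_rV (W `&` B) * ((fine (lebesgue_rV W))^-1)%:E)%E.

End probabilistic_notions.

(* Main.v *)
Require Import Defs.
From HB Require Import structures.
From mathcomp Require Import all_boot all_order all_algebra fingroup perm.
From mathcomp Require Import all_classical all_reals all_analysis.
From mathcomp Require Import measurable_realfun ring lra.

Set Implicit Arguments.
Unset Strict Implicit.
Unset Printing Implicit Defensive.

Import Order.TTheory GRing.Theory Num.Theory.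
Import numFieldNormedType.Exports.

Local Open Scope classical_set_scope.
Local Open Scope ring_scope.

(** The functional [L] is a sum over pairs whose local contributions are
    controlled by vertex degrees, so it concentrates around its median by
    Talagrand's convex distance inequality; the price is the event that some
    degree is large, which a Chernoff bound makes unlikely.

    Convex distance ([talagrand]).  For a product measure, a measurable set [A]
    and measurable [F] and [a_i >= 0] such that
    [F x <= \sum_i (2 a_i(x) 1(x_i <> y_i) - a_i(x)^2)] for all [y] in [A], one
    has [P(A) E(exp(F/4)) <= 1].  Maximising the right-hand side over
    [a = a(x)] gives the squared convex distance of [x] to [A], so this is
    Talagrand's inequality with the supremum over [a] replaced by a measurable
    choice of the weights.  It is proved by his induction on the number of
    coordinates; with the weights given, every integrand is measurable and no
    projection of [A] is ever needed.

    Application ([concentration_convex_distance]).  Let [local_sum x i] be the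
    total weight of the edges at the [i]-th point.  Replacing the sample [x] by
    [y] destroys at most the edges at the points that were moved, hence
    [L x - L y <= \sum_i local_sum x i * 1(x_i <> y_i)].  If all degrees are at
    most [r], then [local_sum x i <= delta^tau r], so
    [\sum_i local_sum x i ^ 2 <= 2 delta^tau r L x].  Taking [a] proportional to
    [local_sum] yields
    [P(L <= b) P(L >= b + u, degrees <= r) <= exp(- u^2 / (8 delta^tau r M))]
    whenever [b + u <= M] and [u <= M].  The cases [b = m] and [b = m - u], with
    [M = u + m], bound the two tails around the median [m].

    Degrees ([max_degree_tail]).  Given its position, the degree of a point is
    binomial with success probability at most [kappa_d delta^d], the volume of a
    ball ([lebesgue_rV_ball]).  Hence, with [lam = n kappa_d delta^d], some degree
    exceeds [r] with probability at most
    [exp(ln n + lam (e^s - 1) - s r)] for every [s > 0].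

    Both error terms are balanced when [r] is [lam] times the larger root of a
    quadratic equation; that root is the expression minimised in [xstar]
    ([chernoff_root]), and minimising over [s] gives the first bound.  The second
    one takes [s = 1] and [r = ln n + 2 lam + u / sqrt(8 delta^tau (u + m))]. *)

(** * The one-dimensional inequality behind the induction *)

Section real_inequalities.
Context {R : realType}.
Implicit Types l rho : R.

Lemma expR_convex t (a b : R) : 0 <= t <= 1 ->
  expR (t * a + (1 - t) * b) <= t * expR a + (1 - t) * expR b.
Proof.
by move=> /andP[t0 t1]; have := convex_expR (Itv01 t0 t1) a b; rewrite !convRE.
Qed.

(** Equality holds at [l = 0], and [e^(l - l^2) + e^(-l)] is nonincreasing on
    [[0, 1/2]] because [1 - 2 l <= e^(- 2 l + l^2)]. *)
Lemma expR_sub_sqr_le l : 0 <= l -> l <= 2^-1 ->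
  expR (l - l ^+ 2) <= 2 - expR (- l).
Proof.
move=> l0 l12.
pose g := fun x : R => expR (x - x ^+ 2) + expR (- x).
have dg (x : R) : is_derive x (1:R) g ((1 - 2 * x) * expR (x - x ^+ 2) - expR (- x)).
  have h1 : is_derive x (1:R) (fun x : R => x - x ^+ 2) (1 - 2 * x).
    apply: is_derive_eq; rewrite /GRing.scale/=; ring.
  apply: is_derive_eq.
  by rewrite /GRing.scale/=; ring.
suff : g l <= g 0 by rewrite /g expr0n/= subr0 oppr0 expR0; lra.
apply: (@ler0_derive1_nincr R g 0 (2^-1)) => //.
- move=> x; rewrite in_itv/= => /andP[x0 x1].
  rewrite derive1E (@derive_val _ _ _ _ _ _ _ (dg x)) subr_le0.
  have -> : - x = (x - x ^+ 2) + (- (2 * x) + x ^+ 2) by ring.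
  rewrite (expRD (x - x ^+ 2)) mulrC ler_pM2l ?expR_gt0//.
  apply: le_trans (expR_ge1Dx _); have := sqr_ge0 x; lra.
- apply/continuous_subspaceT => x; apply: differentiable_continuous.
  by apply/derivable1_diffP; have [] := dg x.
Qed.

(** The optimisation over the mixing parameter [t] in Talagrand's induction.
    The minimiser of the exponent is [1 + 2 ln rho], or [0] when that is
    negative. *)
Lemma talagrand_exponent rho : 0 <= rho <= 1 ->
  exists t, [/\ 0 <= t <= 1, rho = 0 -> t = 0 &
    expR ((1 - t) ^+ 2 / 4 - t * ln rho) <= 2 - rho].
Proof.
move=> /andP[rho0 rho1].
have [hlow|hhigh] := leP rho (expR (- 2^-1)).
  exists 0; split => //; first by rewrite lexx ler01.
  rewrite mul0r subr0 subr0 expr1n mul1r.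
  have h1 : expR (4^-1 : R) <= 4 / 3.
    have := expR_ge1Dx (- 4^-1 : R); rewrite expRN => h.
    rewrite -[leLHS]invrK (_ : 4 / 3 = (3 / 4)^-1); last by rewrite invf_div.
    rewrite lef_pV2 ?posrE ?invr_gt0 ?expR_gt0//; lra.
  have h2 : expR (- 2^-1 : R) <= 16 / 25.
    rewrite expRN (_ : 16 / 25 = (25 / 16)^-1); last by rewrite invf_div.
    rewrite lef_pV2 ?posrE ?expR_gt0//.
    have -> : (2^-1 : R) = 4^-1 + 4^-1 by lra.
    rewrite expRD; have := expR_ge1Dx (4^-1 : R) => h.
    have -> : (25 / 16 : R) = (5/4) * (5/4) by lra.
    by apply: ler_pM; lra.
  lra.
have rhogt : 0 < rho by rewrite (lt_trans _ hhigh)// expR_gt0.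
pose l := - ln rho.
have l0 : 0 <= l by rewrite oppr_ge0 ln_le0.
have l12 : l <= 2^-1.
  by rewrite /l lerNl -[leLHS]expRK ler_ln ?posrE ?expR_gt0// ltW.
exists (1 - 2 * l); split; first lra.
  by move=> r0; rewrite r0 ltxx in rhogt.
have := expR_sub_sqr_le l0 l12.
rewrite {3}/l opprK lnK ?posrE// => /(le_trans _); apply.
rewrite ler_expR.
have -> : ln rho = - l by rewrite opprK.
lra.
Qed.

End real_inequalities.

(** * Powers of a probability measure *)

Section power.
Context d (T : measurableType d) (R : realType) (mu : probability T R).

Definition cons_tuple n (p : T * n.-tuple T) : n.+1.-tuple T :=
  [tuple of p.1 :: p.2].

Lemma measurable_cons_tuple n :
  measurable_fun [set: T * n.-tuple T] (@cons_tuple n).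
Proof. exact: (measurable_cons measurable_fst measurable_snd). Qed.

HB.instance Definition _ n := isMeasurableFun.Build _ _ _ _ (@cons_tuple n)
  (@measurable_cons_tuple n).

Fixpoint power n : probability (n.-tuple T) R :=
  match n with
  | 0 => dirac ([tuple] : 0.-tuple T)
  | m.+1 => distribution (product_measure1 mu (power m)) (@cons_tuple m)
  end.

Lemma powerS n (A : set (n.+1.-tuple T)) : measurable A ->
  (power n.+1 A = \int[mu]_w power n [set x | A (cons_tuple (w, x))])%E.
Proof.
move=> mA; rewrite /= /distribution /pushforward /product_measure1.
by apply: eq_integral => w _ /=; congr (power n _); rewrite xsectionE.
Qed.

Lemma measurable_slice n (w : T) : measurable_fun [set: n.-tuple T]
  (fun x => cons_tuple (w, x)).
Proof. exact: measurableT_comp. Qed.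

Lemma ge0_integral_powerS n (f : n.+1.-tuple T -> \bar R) :
  measurable_fun [set: n.+1.-tuple T] f -> (forall x, 0 <= f x)%E ->
  (\int[power n.+1]_x f x = \int[mu]_w \int[power n]_x f (cons_tuple (w, x)))%E.
Proof.
move=> mf f0.
rewrite /= ge0_integral_distribution// fubini_tonelli1//.
  exact: measurableT_comp.
by move=> x; exact: f0.
Qed.

Lemma measurable_power_slice n (A : set (n.+1.-tuple T)) : measurable A ->
  measurable_fun [set: T] (fun w => power n [set x | A (cons_tuple (w, x))]).
Proof.
move=> mA; have := @measurable_fun_xsection _ _ T (n.-tuple T) R (power n)
  (@cons_tuple n @^-1` A).
rewrite (_ : (fun _ => _) = power n \o xsection (@cons_tuple n @^-1` A)).
  by apply; rewrite -[X in measurable X]setTI; exact: measurable_cons_tuple.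
by apply/funext => w /=; congr (power n _); rewrite xsectionE.
Qed.

Lemma measurable_rectangle n (A : 'I_n -> set T) :
  (forall i, measurable (A i)) ->
  measurable [set x : n.-tuple T | forall i, A i (tnth x i)].
Proof.
move=> mA.
rewrite (_ : mkset _ = \bigcap_(i in [set: 'I_n]) ((@tnth _ T ^~ i) @^-1` A i)).
  apply: fin_bigcap_measurable => // i _.
  by rewrite -[X in measurable X]setTI; exact: measurable_tnth.
by apply/seteqP; split=> x /= h; [move=> i _; exact: h|move=> i; exact: h].
Qed.

Lemma power_rectangle n (A : 'I_n -> set T) : (forall i, measurable (A i)) ->
  (power n [set x | forall i, A i (tnth x i)] = \prod_i mu (A i))%E.
Proof.
elim: n A => [|n IH] A mA.
  rewrite big_ord0 /= diracE mem_set//=; by case.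
rewrite powerS; last exact: measurable_rectangle.
have E w : power n [set x | forall i, A i (tnth (cons_tuple (w, x)) i)] =
    ((\1_(A ord0) w)%:E * \prod_i mu (A (lift ord0 i)))%E.
  rewrite indicE; have [wA|wA] := boolP (w \in A ord0).
    rewrite mul1e -IH//; congr (power n _); apply/seteqP; split=> x /= h i.
      by have := h (lift ord0 i); rewrite tnthS.
    case: (unliftP ord0 i) => [j|] ->; first by rewrite tnthS.
    by rewrite tnth0; exact: set_mem.
  rewrite mul0e (_ : mkset _ = set0) ?measure0//; apply/seteqP; split=> x //= h.
  by move/negP: wA; apply; apply/mem_set; have := h ord0; rewrite tnth0.
under eq_integral do rewrite E.
rewrite ge0_integralZr//=.
- by rewrite integral_indic// setIT big_ord_recl.
- exact/measurable_EFinP.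
- by apply: prode_ge0 => i _.
Qed.

Lemma measurable_tupleE n : measurable = <<s [set B : set (n.-tuple T) |
  exists2 A : 'I_n -> set T, (forall i, measurable (A i)) &
    B = [set x | forall i, A i (tnth x i)]] >>.
Proof.
apply/seteqP; split; apply: smallest_sub; last 2 first.
- exact: sigma_algebra_measurable.
- by move=> _ [A mA ->]; exact: measurable_rectangle.
- exact: smallest_sigma_algebra.
rewrite -bigcup_seq/=; apply: bigcup_sub => j _ _ [A mA <-].
apply: sub_sigma_algebra.
exists (fun i => if i == j then A else setT) => [i|]; first by case: ifP.
apply/seteqP; split=> x /=.
  by move=> [_ xA] i; case: eqP => // ->.
by move=> /(_ j); rewrite eqxx.
Qed.

(** Rectangles form a pi-system that generates the sigma-algebra of tuples. *)
Lemma power_unique n (nu : probability (n.-tuple T) R) :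
  (forall A : 'I_n -> set T, (forall i, measurable (A i)) ->
    nu [set x | forall i, A i (tnth x i)] = (\prod_i mu (A i))%E) ->
  forall S, measurable S -> nu S = power n S.
Proof.
move=> nuA S mS.
apply: (measure_unique _ (fun=> setT) (measurable_tupleE n)) => //.
- move=> _ _ [A mA ->] [B mB ->]; exists (fun i => A i `&` B i).
    by move=> i; exact: measurableI.
  apply/seteqP; split=> x /=; first by move=> [h1 h2] i; split.
  by move=> h; split=> i; have [] := h i.
- by move=> _; exists (fun=> setT) => //; apply/seteqP; split.
- by rewrite bigcup_const//; exists 0.
- move=> _ [A mA ->]; exact: (etrans (nuA A mA) (esym (power_rectangle mA))).
- by move=> k; rewrite (le_lt_trans (probability_le1 _ _)) ?ltry.
Qed.

Lemma measurable_mktuple d0 (Om : measurableType d0) n (X : 'I_n -> Om -> T) :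
  (forall i, measurable_fun [set: Om] (X i)) ->
  measurable_fun [set: Om] (fun w => [tuple X i w | i < n]).
Proof.
move=> mX; apply/measurable_fun_tnthP => i; rewrite (_ : _ \o _ = X i)//.
by apply/funext => w /=; rewrite tnth_mktuple.
Qed.

Lemma power_law n d0 (Om : measurableType d0) (P : probability Om R)
    (X : 'I_n -> {RV P >-> T}) (S : set (n.-tuple T)) :
  mutually_independent X ->
  (forall i B, measurable B -> P (X i @^-1` B) = mu B) ->
  measurable S -> P [set w | S [tuple X i w | i < n]] = power n S.
Proof.
move=> indX lawX mS.
pose Y : {mfun Om >-> n.-tuple T} := HB.pack (fun w => [tuple X i w | i < n])
  (isMeasurableFun.Build _ _ _ _ _
    (measurable_mktuple (fun i => measurable_funPT (X i)))).
apply: (@power_unique n (distribution P Y)) mS => A mA.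
have := indX [set: 'I_n]%SET A mA.
under [X in _ = X]eq_bigr do rewrite lawX//.
rewrite big_set/= => <-; rewrite /distribution /pushforward.
congr (P _); apply/seteqP; split=> w /=.
  by move=> h' i _; have := h' i; rewrite tnth_mktuple.
by move=> h' i; rewrite tnth_mktuple; apply: h' => /=; rewrite inE.
Qed.

Lemma power_perm n (s : {perm 'I_n}) (S : set (n.-tuple T)) : measurable S ->
  power n [set x | S [tuple tnth x (s i) | i < n]] = power n S.
Proof.
move=> mS.
pose Y : {mfun n.-tuple T >-> n.-tuple T} :=
  HB.pack (fun x : n.-tuple T => [tuple tnth x (s i) | i < n])
  (isMeasurableFun.Build _ _ _ _ _
    (measurable_mktuple (fun i => @measurable_tnth _ T n (s i)))).
apply: (@power_unique n (distribution (power n) Y)) mS => A mA.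
rewrite /distribution /pushforward (reindex_perm s^-1%g)/=.
rewrite -power_rectangle; last by move=> i.
congr (power n _); apply/seteqP; split=> x /= h i.
  by have := h (s^-1 i)%g; rewrite tnth_mktuple permKV.
by rewrite tnth_mktuple; have := h (s i); rewrite permK.
Qed.

End power.

(** * Talagrand's convex distance inequality *)

Section talagrand.
Context d (T : measurableType d) (R : realType) (mu : probability T R).
Local Open Scope ereal_scope.

Lemma power_fineK n (A : set (n.-tuple T)) : measurable A ->
  (fine (power mu n A))%:E = power mu n A.
Proof. by move=> mA; rewrite fineK// fin_num_measure. Qed.

(** One coordinate of the induction, for a fixed value of the new coordinate.
    In the application [al] is the weight of that coordinate, [p] and [q] are
    the measures of two slices of the set: the one at the current value of
    the coordinate, where no distance is paid, and a nearly largest one, where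
    the coordinate may differ and at most [2 al] is paid.  Since
    [F = t (F + al^2) + (1 - t) (F + al^2 - 2 al) + (1 - t)^2 - (al - (1 - t))^2],
    the conclusion is an interpolation between the two bounds, in which
    [t * ln p] vanishes by convention when [p = 0]. *)
Lemma hoelder_step n (F al : n.-tuple T -> R) (p q t : R) :
  measurable_fun [set: n.-tuple T] F -> measurable_fun [set: n.-tuple T] al ->
  (0 <= t <= 1)%R -> (0 <= p)%R -> (0 < q)%R -> (p = 0 -> t = 0)%R ->
  p%:E * \int[power mu n]_x (expR ((F x + al x ^+ 2) / 4))%:E <= 1 ->
  q%:E * \int[power mu n]_x (expR ((F x + al x ^+ 2 - 2 * al x) / 4))%:E <= 1 ->
  \int[power mu n]_x (expR (F x / 4))%:E <=
    (expR ((1 - t) ^+ 2 / 4 - t * ln p - (1 - t) * ln q))%:E.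
Proof.
move=> mF mal t01 p0 q0 pt hp hq.
have /andP[t0 t1] := t01.
set k := expR _.
pose U x := expR ((F x + al x ^+ 2) / 4).
pose V x := expR ((F x + al x ^+ 2 - 2 * al x) / 4).
have mU : measurable_fun [set: n.-tuple T] U.
  apply: measurableT_comp => //; apply: measurable_funM => //.
  by apply: measurable_funD => //; exact: measurable_funX.
have mV : measurable_fun [set: n.-tuple T] V.
  apply: measurableT_comp => //; apply: measurable_funM => //.
  apply: measurable_funB; last exact: measurable_funM.
  by apply: measurable_funD => //; exact: measurable_funX.
(* Convexity of the exponential, in place of Hoelder's inequality. *)
have FE x : (expR (F x / 4) <= k * (t * (p * U x) + (1 - t) * (q * V x)))%R.
  have -> : (t * (p * U x) = t * expR ((F x + al x ^+ 2) / 4 + ln p))%R.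
    have [p0'|pn0] := eqVneq p 0%R; first by rewrite (pt p0') !mul0r.
    by rewrite expRD lnK ?posrE ?lt_neqAle 1?eq_sym ?pn0// [(p * _)%R]mulrC.
  have -> : (q * V x = expR ((F x + al x ^+ 2 - 2 * al x) / 4 + ln q))%R.
    by rewrite expRD lnK ?posrE// mulrC.
  apply: le_trans (ler_wpM2l (expR_ge0 _) (expR_convex _ _ t01)).
  rewrite -expRD ler_expR.
  rewrite -subr_ge0 [leRHS](_ : _ = (al x - (1 - t)) ^+ 2 / 4)%R.
    by rewrite divr_ge0// sqr_ge0.
  by field.
have U0 x : (0 <= U x)%R by exact: expR_ge0.
have V0 x : (0 <= V x)%R by exact: expR_ge0.
apply: (@le_trans _ _ (\int[power mu n]_x
    (k * (t * (p * U x) + (1 - t) * (q * V x)))%:E)).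
  apply: ge0_le_integral => //.
  - apply/measurable_EFinP; apply: measurableT_comp => //.
    exact: measurable_funM.
  - apply/measurable_EFinP; apply: measurable_funM => //.
    by apply: measurable_funD; do 2! apply: measurable_funM => //.
  - by move=> x _; rewrite lee_fin.
under eq_integral do rewrite EFinM.
rewrite ge0_integralZl_EFin ?expR_ge0//; last 2 first.
- by move=> x _; rewrite lee_fin addr_ge0// !mulr_ge0 ?subr_ge0// ltW.
- apply/measurable_EFinP.
  by apply: measurable_funD; do 2! apply: measurable_funM => //.
rewrite -[leRHS]mule1 lee_wpmul2l ?lee_fin ?expR_ge0//.
under eq_integral do rewrite EFinD.
rewrite ge0_integralD//; last 4 first.
- by move=> x _; rewrite lee_fin !mulr_ge0.
- by apply/measurable_EFinP; do 2! apply: measurable_funM => //.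
- by move=> x _; rewrite lee_fin !mulr_ge0 ?subr_ge0// ltW.
- by apply/measurable_EFinP; do 2! apply: measurable_funM => //.
have lin s r (G : n.-tuple T -> R) : (0 <= s)%R -> (0 <= r)%R ->
    (forall x, 0 <= G x)%R -> measurable_fun [set: n.-tuple T] G ->
    r%:E * \int[power mu n]_x (G x)%:E <= 1 ->
    \int[power mu n]_x (s * (r * G x))%:E <= s%:E.
  move=> s0 r0 G0 mG rG.
  under eq_integral do rewrite mulrA EFinM.
  rewrite ge0_integralZl_EFin ?mulr_ge0//; last 2 first.
  - by move=> x _; rewrite lee_fin.
  - exact/measurable_EFinP.
  by rewrite EFinM -muleA -[leRHS]mule1 lee_wpmul2l ?lee_fin.
have -> : 1 = t%:E + (1 - t)%:E by rewrite -EFinD subrKC.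
by rewrite leeD// lin// ?subr_ge0// ltW.
Qed.


(** Talagrand's inequality with explicit weights [a].  Slicing at a value [w] of
    the first coordinate preserves the hypothesis on [F]: for the slice of [A]
    at the same [w], with [F + a_0^2]; for the slice of [A] at any other value,
    with [F + a_0^2 - 2 a_0].  Interpolating between the slice at [w] and one of
    measure close to the supremum [v] bounds the inner integral, up to a factor
    close to [1], by [(2 - p(w) / v) / v], where [p(w)] is the measure of the slice at [w], and
    [z (2 - z) <= 1] for [z = P(A) / v] finishes the induction. *)
Theorem talagrand n (A : set (n.-tuple T)) (F : n.-tuple T -> R)
    (a : 'I_n -> n.-tuple T -> R) :
  measurable A -> measurable_fun [set: n.-tuple T] F ->
  (forall i, measurable_fun [set: n.-tuple T] (a i)) ->
  (forall i x, 0 <= a i x)%R ->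
  (forall x y, A y -> F x <=
    \sum_i (2 * a i x * (tnth x i != tnth y i)%:R - a i x ^+ 2))%R ->
  power mu n A * \int[power mu n]_x (expR (F x / 4))%:E <= 1.
Proof.
elim: n A F a => [|n IH] A F a mA mF ma a0 dom.
  have [A0|A0] := pselect (A [tuple]); last first.
    by rewrite /= diracE memNset// mul0e.
  rewrite /= diracE mem_set// mul1e integral_dirac//; last first.
    by apply/measurable_EFinP; apply: measurableT_comp => //; exact: measurable_funM.
  rewrite diracT mul1e lee_fin expR_le1.
  have := dom [tuple] [tuple] A0; rewrite big_ord0 => F0.
  by rewrite pmulr_lle0.
pose Aw w := [set x | A (cons_tuple (w, x))].
have mAw w : measurable (Aw w).
  by rewrite -[X in measurable X]setTI; exact: measurable_slice.
pose p w := fine (power mu n (Aw w)).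
have pE w : (p w)%:E = power mu n (Aw w) by rewrite power_fineK.
have p0 w : (0 <= p w)%R by rewrite fine_ge0.
have p1 w : (p w <= 1)%R by rewrite -lee_fin pE probability_le1.
pose Fw w x := F (cons_tuple (w, x)).
pose al w x := a ord0 (cons_tuple (w, x)).
have ms (f : n.+1.-tuple T -> R) w : measurable_fun [set: n.+1.-tuple T] f ->
    measurable_fun [set: n.-tuple T] (fun x => f (cons_tuple (w, x))).
  by move=> mf; apply: (measurableT_comp mf); exact: measurable_slice.
have mFw w : measurable_fun [set: n.-tuple T] (Fw w) by exact: ms.
have mal w : measurable_fun [set: n.-tuple T] (al w) by exact: ms.
have h1 w : (p w)%:E *
    \int[power mu n]_x (expR ((Fw w x + al w x ^+ 2) / 4))%:E <= 1.
  rewrite pE; apply: (IH _ _ (fun i x => a (lift ord0 i) (cons_tuple (w, x)))) => //.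
  - by apply: measurable_funD => //; exact: measurable_funX.
  - by move=> i; exact: ms.
  move=> x y Ay; have := dom (cons_tuple (w, x)) (cons_tuple (w, y)) Ay.
  rewrite big_ord_recl !tnth0 eqxx mulr0 sub0r -/(Fw w x) -/(al w x).
  by under eq_bigr do rewrite !tnthS; rewrite addrC lerBrDr.
have h2 w w0 : (p w0)%:E *
    \int[power mu n]_x (expR ((Fw w x + al w x ^+ 2 - 2 * al w x) / 4))%:E <= 1.
  rewrite pE; apply: (IH _ _ (fun i x => a (lift ord0 i) (cons_tuple (w, x)))) => //.
  - apply: measurable_funB; last exact: measurable_funM.
    by apply: measurable_funD => //; exact: measurable_funX.
  - by move=> i; exact: ms.
  move=> x y Ay; have := dom (cons_tuple (w, x)) (cons_tuple (w0, y)) Ay.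
  rewrite big_ord_recl !tnth0 -/(Fw w x) -/(al w x).
  under eq_bigr do rewrite !tnthS.
  move=> h; rewrite lerBlDr -lerBrDr; apply: le_trans h _.
  rewrite addrC -addrA lerD2l.
  have := a0 ord0 (cons_tuple (w, x)); rewrite -/(al w x).
  by case: (w != w0); rewrite /= ?mulr1 ?mulr0 => a00; lra.
pose J w := \int[power mu n]_x (expR (Fw w x / 4))%:E.
have mJ : measurable_fun [set: T] J.
  apply: (@measurable_fun_fubini_tonelli_F _ _ T (n.-tuple T) R (power mu n)
     (fun z => (expR (F (cons_tuple z) / 4))%:E)).
  - apply/measurable_EFinP; apply: measurableT_comp => //.
    by apply: measurable_funM => //; exact: measurableT_comp.
  - by move=> z; rewrite lee_fin expR_ge0.
have mp : measurable_fun [set: T] p.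
  apply/measurable_EFinP; rewrite (_ : _ \o _ = fun w => power mu n (Aw w)).
    exact: measurable_power_slice.
  by apply/funext => w /=; rewrite pE.
rewrite ge0_integral_powerS; last 2 first.
- apply/measurable_EFinP; apply: measurableT_comp => //.
  exact: measurable_funM.
- by move=> x; rewrite lee_fin expR_ge0.
rewrite -/(Fw _ _) -/(J _).
have PAE : power mu n.+1 A = \int[mu]_w (p w)%:E.
  by rewrite powerS//; apply: eq_integral => w _; rewrite pE.
pose v := sup (range p).
have pv w : (p w <= v)%R.
  apply: ub_le_sup; last by exists w.
  by exists 1%R => _ [w' _ <-]; exact: p1.
have [v0|v0] := leP v 0%R.
  rewrite PAE integral0_eq ?mul0e// => w _; congr EFin; apply/eqP.
  by rewrite eq_le p0 (le_trans (pv w) v0).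
pose q := fine (power mu n.+1 A).
have qE : q%:E = power mu n.+1 A by rewrite power_fineK.
have q0 : (0 <= q)%R by rewrite fine_ge0.
(* The supremum [v] may not be attained, which costs a factor [c > 1]. *)
have bound c : (1 < c)%R -> power mu n.+1 A * \int[mu]_w J w <= c%:E.
  move=> c1; have c0 : (0 < c)%R by lra.
  have [w0 pw0] : exists w0, (v / c < p w0)%R.
    have vc : (v / c < v)%R by rewrite ltr_pdivrMr// ltr_pMr.
    have : has_sup (range p).
      by apply: contrapT => /sup_out; rewrite -/v => v0'; rewrite v0' ltxx in v0.
    have e0 : (0 < v - v / c)%R by rewrite subr_gt0.
    move=> /(sup_adherent e0); rewrite -/v opprB subrKC => -[_ [w _ <-] h].
    by exists w.
  have pw00 : (0 < p w0)%R by rewrite (lt_trans _ pw0)// divr_gt0.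
  have JE w : J w + (c / v ^+ 2 * p w)%:E <= (2 * c / v)%:E.
    have [|t [t01 tz ht]] := @talagrand_exponent R (p w / v).
      by rewrite divr_ge0 ?(ltW v0)//= ler_pdivrMr// mul1r.
    have pt : (p w = 0 -> t = 0)%R by move=> pw; apply: tz; rewrite pw mul0r.
    have hJ := hoelder_step (mFw w) (mal w) t01 (p0 w) pw00 pt (h1 w) (h2 w w0).
    rewrite -leeBrDr// -EFinB; apply: (le_trans hJ); rewrite lee_fin.
    have -> : (2 * c / v - c / v ^+ 2 * p w = c / v * (2 - p w / v))%R.
      by field; rewrite gt_eqF.
    apply: le_trans (ler_wpM2l _ ht); last by rewrite divr_ge0// ltW.
    rewrite -[(c / v)%R]lnK ?posrE ?divr_gt0// -expRD ler_expR.
    have lnp : (t * ln (p w / v) = t * (ln (p w) - ln v))%R.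
      have [pw|pw] := eqVneq (p w) 0%R; first by rewrite (pt pw) !mul0r.
      by rewrite ln_div ?posrE// lt_neqAle eq_sym pw p0.
    rewrite lnp ln_div ?posrE//.
    have lnq : (ln v - ln c <= ln (p w0))%R.
      by rewrite -ln_div ?posrE// ler_ln ?posrE ?divr_gt0// ltW.
    have lnc : (0 <= ln c)%R by rewrite ln_ge0// ltW.
    have /andP[t0 t1] := t01.
    have : ((1 - t) * (ln v - ln c) <= (1 - t) * ln (p w0))%R.
      by rewrite ler_wpM2l// subr_ge0.
    have : (0 <= t * ln c)%R by rewrite mulr_ge0.
    nra.
  have hint : \int[mu]_w J w + (c / v ^+ 2 * q)%:E <= (2 * c / v)%:E.
    rewrite EFinM qE PAE -ge0_integralZl_EFin//; last 3 first.
    - by move=> w _; rewrite lee_fin.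
    - exact/measurable_EFinP.
    - by rewrite divr_ge0 ?sqr_ge0// ltW.
    rewrite -ge0_integralD//; last 3 first.
    - by move=> w _; apply: integral_ge0 => x _; rewrite lee_fin expR_ge0.
    - by move=> w _; rewrite -EFinM lee_fin mulr_ge0// divr_ge0 ?sqr_ge0// ltW.
    - by apply/measurable_EFinP; exact: measurable_funM.
    apply: (@le_trans _ _ (\int[mu]_w (2 * c / v)%:E)).
      apply: ge0_le_integral => //.
      + move=> w _; rewrite adde_ge0//.
          by apply: integral_ge0 => x _; rewrite lee_fin expR_ge0.
        by rewrite -EFinM lee_fin mulr_ge0// divr_ge0 ?sqr_ge0// ltW.
      + apply: emeasurable_funD => //.
        by apply/measurable_EFinP; exact: measurable_funM.
    by rewrite integral_cst//= probability_setT mule1.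
  rewrite -leeBrDr// -EFinB in hint.
  rewrite -qE; apply: le_trans (lee_wpmul2l _ hint) _; first by rewrite lee_fin.
  rewrite -EFinM lee_fin.
  have -> : (q * (2 * c / v - c / v ^+ 2 * q) = c * (1 - (1 - q / v) ^+ 2))%R.
    by field; rewrite gt_eqF.
  by rewrite ger_pMr// gerBl sqr_ge0.
apply/lee_addgt0Pr => e e0.
by rewrite -EFinD; apply: bound; rewrite ltrDl.
Qed.

End talagrand.

(** * Tails of vertex degrees *)

Section degree.
Context d (T : measurableType d) (R : realType) (mu : probability T R).
Variable N : set (T * T).
Hypothesis mN : measurable N.

Definition degree n (x : n.-tuple T) (i : 'I_n) : R :=
  \sum_(j | j != i) \1_N (tnth x i, tnth x j).

Let mN1 : measurable_fun [set: T * T] (\1_N : T * T -> R).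
Proof. exact: measurable_indic. Qed.

Lemma measurable_neighbour n (i j : 'I_n) :
  measurable_fun [set: n.-tuple T] (fun x => \1_N (tnth x i, tnth x j) : R).
Proof.
apply: (measurableT_comp mN1).
by apply: measurable_fun_pair; exact: measurable_tnth.
Qed.

Lemma measurable_degree n (i : 'I_n) :
  measurable_fun [set: n.-tuple T] (fun x => degree x i).
Proof.
rewrite /degree; under eq_fun do rewrite big_mkcond/=.
by apply: measurable_sum => j; case: (j != i) => //; exact: measurable_neighbour.
Qed.

Lemma measurable_degree_gt n (i : 'I_n) (r : R) :
  measurable [set x : n.-tuple T | r < degree x i].
Proof.
rewrite -[X in measurable X]setTI.
rewrite (_ : mkset _ = (fun x => degree x i) @^-1` `]r, +oo[).
  by apply: measurable_degree.
by apply/seteqP; split=> x /=; rewrite in_itv/= andbT.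
Qed.

Lemma integral_power_prod n (h : T -> R) (b : R) :
  measurable_fun [set: T] h -> (forall x, 0 <= h x) -> 0 <= b ->
  (\int[mu]_x (h x)%:E <= b%:E)%E ->
  (\int[power mu n]_x (\prod_i h (tnth x i))%:E <= (b ^+ n)%:E)%E.
Proof.
move=> mh h0 b0 hb.
have mprod k : measurable_fun [set: k.-tuple T]
    (fun x => \prod_i h (tnth x i)).
  apply: measurable_prod => i _.
  by apply: measurableT_comp => //; exact: measurable_tnth.
elim: n => [|n IH].
  rewrite expr0; under eq_integral do rewrite big_ord0.
  by rewrite integral_cst//= diracT mule1.
rewrite ge0_integral_powerS; last 2 first.
- by apply/measurable_EFinP; exact: mprod.
- by move=> x; rewrite lee_fin prodr_ge0.
have E w : (\int[power mu n]_x (\prod_i h (tnth (cons_tuple (w, x)) i))%:E =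
    (h w)%:E * \int[power mu n]_x (\prod_i h (tnth x i))%:E)%E.
  rewrite -ge0_integralZl_EFin//; last 2 first.
  - by move=> x _; rewrite lee_fin prodr_ge0.
  - by apply/measurable_EFinP; exact: mprod.
  apply: eq_integral => x _; rewrite big_ord_recl tnth0 EFinM.
  by congr (_ * _%:E)%E; apply: eq_bigr => i _; rewrite tnthS.
under eq_integral do rewrite E.
rewrite ge0_integralZr//=; last 3 first.
- exact/measurable_EFinP.
- by move=> x _; rewrite lee_fin.
- by apply: integral_ge0 => x _; rewrite lee_fin prodr_ge0.
rewrite exprS EFinM lee_pmul// ?integral_ge0// => x _; rewrite lee_fin//.
exact: prodr_ge0.
Qed.

Variable p : R.
Hypothesis p_ge0 : 0 <= p.
Hypothesis Np : forall w, (mu [set y | N (w, y)] <= p%:E)%E.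

Lemma mgf_neighbour (s : R) (w : T) : 0 <= s ->
  (\int[mu]_y (expR (s * \1_N (w, y)))%:E <= (expR (p * (expR s - 1)))%:E)%E.
Proof.
move=> s0.
have mNw : measurable [set y | N (w, y)].
  by rewrite -[X in measurable X]xsectionE; exact: measurable_xsection.
have e0 : 0 <= expR s - 1 by rewrite subr_ge0 -expR0 ler_expR.
under eq_integral => y _.
  rewrite (_ : expR _ = 1 + (expR s - 1) * \1_[set y | N (w, y)] y); last first.
    rewrite !indicE (_ : (y \in [set y | N (w, y)]) = ((w, y) \in N)).
      by case: (_ \in _); rewrite /= ?mulr1 ?mulr0 ?expR0; ring.
    by apply/idP/idP => /set_mem h; apply/mem_set.
  rewrite EFinD EFinM.
  over.
rewrite ge0_integralD//; last 2 first.
- by move=> y _; rewrite -EFinM lee_fin mulr_ge0.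
- by apply/measurable_EFinP; apply: measurable_funM => //.
rewrite integral_cst//= probability_setT mule1 ge0_integralZl_EFin//; last first.
  exact/measurable_EFinP.
rewrite integral_indic// setIT.
apply: (@le_trans _ _ (1%:E + (expR s - 1)%:E * p%:E)%E).
  by rewrite leeD2l// lee_wpmul2l ?lee_fin// Np.
rewrite -EFinM -EFinD lee_fin mulrC; exact: expR_ge1Dx.
Qed.

(** Given the first point, the other [n] points are independent, each a
    neighbour with probability at most [p]. *)
Lemma mgf_degree0 n (s : R) : 0 <= s ->
  (\int[power mu n.+1]_x (expR (s * degree x ord0))%:E <=
   (expR (n%:R * (p * (expR s - 1))))%:E)%E.
Proof.
move=> s0; rewrite ge0_integral_powerS; last 2 first.
- apply/measurable_EFinP; apply: measurableT_comp => //.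
  by apply: measurable_funM => //; exact: measurable_degree.
- by move=> x; rewrite lee_fin expR_ge0.
rewrite -[leRHS]mule1 -(probability_setT mu) -integral_cst//.
have mNw w : measurable_fun [set: T] (fun y => expR (s * \1_N (w, y))).
  apply: measurableT_comp => //; apply: measurable_funM => //.
  by apply: (measurableT_comp mN1).
apply: ge0_le_integral => //.
- by move=> w _; apply: integral_ge0 => x _; rewrite lee_fin expR_ge0.
- apply: (@measurable_fun_fubini_tonelli_F _ _ T (n.-tuple T) R (power mu n)
     (fun z => (expR (s * degree (cons_tuple z) ord0))%:E)).
  + apply/measurable_EFinP; apply: measurableT_comp => //.
    apply: measurable_funM => //.
    by apply: (measurableT_comp (@measurable_degree _ ord0)).
  + by move=> z; rewrite lee_fin expR_ge0.
move=> w _; rewrite /cst expRM_natl.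
apply: le_trans (integral_power_prod n (mNw w) _ _ (mgf_neighbour w s0)).
- rewrite le_eqVlt; apply/orP; left; apply/eqP; apply: eq_integral => x _.
  congr EFin; rewrite /degree mulr_sumr expR_sum big_mkcond big_ord_recl/=.
  by rewrite mul1r; apply: eq_bigr => j _; rewrite tnth0 tnthS.
- by move=> y; exact: expR_ge0.
- exact: expR_ge0.
Qed.

Lemma degree0_tail n (s r : R) : 0 < s ->
  (power mu n.+1 [set x | (r < degree x ord0)%R] <=
   (expR (n.+1%:R * p * (expR s - 1) - s * r))%:E)%E.
Proof.
move=> s0.
have mD := @measurable_degree_gt n.+1 ord0 r.
have mE : measurable_fun [set: n.+1.-tuple T]
    (fun x => expR (s * degree x ord0)).
  apply: measurableT_comp => //.
  by apply: measurable_funM => //; exact: measurable_degree.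
set A := mkset _.
have markov : ((expR (s * r))%:E * power mu n.+1 A <=
    \int[power mu n.+1]_x (expR (s * degree x ord0))%:E)%E.
  have -> : power mu n.+1 A = (\int[power mu n.+1]_x (\1_A x)%:E)%E.
    by rewrite integral_indic// setIT.
  rewrite -ge0_integralZl_EFin//; last exact/measurable_EFinP/measurable_indic.
  apply: ge0_le_integral => //.
  - by apply/measurable_EFinP; apply: measurable_funM => //; exact: measurable_indic.
  - exact/measurable_EFinP.
  move=> x _; rewrite -EFinM lee_fin indicE.
  have [/set_mem /= xr|_] := boolP (x \in _); last by rewrite mulr0 expR_ge0.
  by rewrite mulr1 ler_expR ler_pM2l// ltW.
have -> : power mu n.+1 A =
    ((expR (- (s * r)))%:E * ((expR (s * r))%:E * power mu n.+1 A))%E.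
  by rewrite muleA -EFinM -expRD addNr expR0 mul1e.
rewrite addrC expRD EFinM lee_wpmul2l ?lee_fin ?expR_ge0//.
apply: le_trans markov _; apply: le_trans (mgf_degree0 n (ltW s0)) _.
rewrite lee_fin ler_expR -mulrA ler_wpM2r ?ler_nat//.
by rewrite mulr_ge0// subr_ge0 -expR0 ler_expR ltW.
Qed.

(** By exchangeability of the coordinates it suffices to treat the first one. *)
Lemma degree_tail n (i : 'I_n) (s r : R) : 0 < s ->
  (power mu n [set x | (r < degree x i)%R] <=
   (expR (n%:R * p * (expR s - 1) - s * r))%:E)%E.
Proof.
case: n i => [[]//|n] i s0.
apply: le_trans (degree0_tail n r s0).
rewrite le_eqVlt; apply/orP; left; apply/eqP.
rewrite -(power_perm mu (tperm ord0 i) (measurable_degree_gt ord0 r)).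
congr (power mu n.+1 _); apply/seteqP.
suff E (x : n.+1.-tuple T) :
    degree [tuple tnth x (tperm ord0 i k) | k < n.+1] ord0 = degree x i.
  by split=> x /=; rewrite E.
rewrite /degree [RHS](reindex_inj (@perm_inj _ (tperm ord0 i)))/=.
apply: eq_big => [j|j _]; last by rewrite !tnth_mktuple tpermL.
by rewrite -{2}(tpermL ord0 i) (inj_eq perm_inj).
Qed.

Lemma max_degree_tail n (s r : R) : 0 < s ->
  (power mu n [set x | exists i, (r < degree x i)%R] <=
   (n%:R * expR (n%:R * p * (expR s - 1) - s * r))%:E)%E.
Proof.
move=> s0.
apply: (@le_trans _ _ (\sum_(i \in [set: 'I_n])
    power mu n [set x | r < degree x i]%R)%E).
  apply: content_sub_fsum.
  - exact: finite_finset.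
  - by move=> i _; exact: measurable_degree_gt.
  - rewrite (_ : mkset _ = \bigcup_(i in [set: 'I_n]) [set x | r < degree x i]).
      by apply: fin_bigcup_measurable => // i _; exact: measurable_degree_gt.
    by apply/seteqP; split=> x /= [i]; [exists i|move=> _ ?; exists i].
  - by move=> x [i]; exists i.
rewrite (_ : [set: 'I_n] = [set` index_enum 'I_n]); last first.
  by apply/seteqP; split=> i //= _; rewrite mem_index_enum.
rewrite -fsbig_seq ?index_enum_uniq//.
apply: (@le_trans _ _ (\sum_(i < n) (expR (n%:R * p * (expR s - 1) - s * r))%:E)%E).
  by apply: lee_sum => i _; exact: degree_tail.
by rewrite sumEFin sumr_const card_ord -[X in (X%:E <= _)%E]mulr_natl.
Qed.

End degree.

(** * Pair sums over the distinct points of a sample *)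

Section pair_sum.
Context d (T : measurableType d) (R : realType).
Variable f : T * T -> R.

(** A sample with repeated points is the same set of points as its list of first
    occurrences, so a sum over pairs of distinct points of the set is a sum over
    pairs of first occurrences. *)
Definition first_occ n (x : n.-tuple T) (i : 'I_n) : bool :=
  [forall k : 'I_n, (k < i)%N ==> (tnth x k != tnth x i)].

Lemma first_occ_inj n (x : n.-tuple T) (i j : 'I_n) :
  first_occ x i -> first_occ x j -> tnth x i = tnth x j -> i = j.
Proof.
move=> /forallP fi /forallP fj xij; apply/val_inj => /=.
have [ij|ji|//] := ltngtP (val i) (val j).
  by have := fj i; rewrite ij xij eqxx.
by have := fi j; rewrite ji xij eqxx.
Qed.

Lemma first_occ_exists n (y : n.-tuple T) (i : 'I_n) :
  exists k, first_occ y k /\ tnth y k = tnth y i.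
Proof.
have [k /eqP yk kmin] := @arg_minnP _ i (fun k => tnth y k == tnth y i) val (eqxx _).
exists k; split=> //; apply/forallP => l; apply/implyP => lk.
apply/negP => /eqP ylk; have := kmin l; rewrite ylk yk eqxx => /(_ isT).
by rewrite leqNgt lk.
Qed.

Definition pair_weight n (x : n.-tuple T) (i j : 'I_n) : R :=
  [&& first_occ x i, first_occ x j & i != j]%:R * f (tnth x i, tnth x j).

Definition local_sum n (x : n.-tuple T) (i : 'I_n) : R :=
  \sum_j pair_weight x i j.

Definition pair_sum n (x : n.-tuple T) : R := 2^-1 * \sum_i local_sum x i.

Hypothesis f_ge0 : forall z, 0 <= f z.

Lemma pair_weight_ge0 n (x : n.-tuple T) i j : 0 <= pair_weight x i j.
Proof. by rewrite mulr_ge0. Qed.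

Lemma local_sum_ge0 n (x : n.-tuple T) i : 0 <= local_sum x i.
Proof. by apply: sumr_ge0 => j _; exact: pair_weight_ge0. Qed.

Lemma pair_sum_ge0 n (x : n.-tuple T) : 0 <= pair_sum x.
Proof. by rewrite mulr_ge0// sumr_ge0// => i _; exact: local_sum_ge0. Qed.

(** A point of [x] left in place is also a point of [y], though possibly with
    another first occurrence [phi i] there; [phi] is injective on first
    occurrences in [x]. *)
Lemma sum_pair_weight_common n (x y : n.-tuple T) :
  \sum_i \sum_j ((tnth x i == tnth y i) && (tnth x j == tnth y j))%:R
     * pair_weight x i j <= \sum_i \sum_j pair_weight y i j.
Proof.
have phiP i := cid (first_occ_exists y i).
pose phi i := projT1 (phiP i).
have phi_first i : first_occ y (phi i) by have [] := projT2 (phiP i).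
have y_phi i : tnth y (phi i) = tnth y i by have [] := projT2 (phiP i).
rewrite !pair_bigA/=.
pose Q (z : 'I_n * 'I_n) := [&& first_occ x z.1, first_occ x z.2, z.1 != z.2,
  tnth x z.1 == tnth y z.1 & tnth x z.2 == tnth y z.2].
pose h (z : 'I_n * 'I_n) := (phi z.1, phi z.2).
have phi_inj i j : first_occ x i -> first_occ x j -> tnth x i = tnth y i ->
    tnth x j = tnth y j -> phi i = phi j -> i = j.
  move=> fi fj xi xj ij; apply: (first_occ_inj fi fj).
  by rewrite xi xj -y_phi ij y_phi.
have h_inj : {in [set z | Q z]%SET &, injective h}.
  move=> [i j] [k l]; rewrite !inE.
  move=> /and5P[/= fi fj _ /eqP xi /eqP xj] /and5P[/= fk fl _ /eqP xk /eqP xl].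
  by move=> [/(phi_inj _ _ fi fk xi xk) -> /(phi_inj _ _ fj fl xj xl) ->].
rewrite (eq_bigr (fun z =>
  if Q z then pair_weight y (h z).1 (h z).2 else 0)); last first.
  move=> [i j] _ /=; rewrite /pair_weight !phi_first/= !y_phi /Q/=.
  case: eqP => [xi|_]; case: eqP => [xj|_]; rewrite ?andbF ?mul0r//=.
  rewrite !andbT !mul1r xi xj.
  case: (boolP (first_occ x i)) => fi; rewrite ?mul0r//=.
  case: (boolP (first_occ x j)) => fj; rewrite ?mul0r//=.
  have [->|ij] := eqVneq i j; rewrite ?mul0r//=.
  by rewrite (_ : phi i != phi j)// (contra_neq _ ij)//; exact: phi_inj.
rewrite -big_mkcond (eq_bigl (fun z => z \in [set z | Q z]%SET)) => [|z]; last first.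
  by rewrite inE.
rewrite -(big_imset (fun z => pair_weight y z.1 z.2) h_inj).
rewrite big_mkcond; apply: ler_sum => z _; case: ifP => // _.
exact: pair_weight_ge0.
Qed.

Hypothesis f_sym : forall p q, f (p, q) = f (q, p).

Lemma pair_weight_sym n (x : n.-tuple T) i j :
  pair_weight x i j = pair_weight x j i.
Proof. by rewrite /pair_weight f_sym andbCA eq_sym. Qed.

(** A pair that contributes to [x] is either common to [x] and [y] or has an
    endpoint that was moved; each pair of the second kind is counted in the local
    sum of a moved endpoint. *)
Lemma pair_sum_sub_le n (x y : n.-tuple T) :
  pair_sum x - pair_sum y <=
  \sum_i local_sum x i * (tnth x i != tnth y i)%:R.
Proof.
rewrite -mulrBr ler_pdivrMl// lerBlDr.
set S := \sum_i _ * _.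
have S1 : S = \sum_i \sum_j (tnth x i != tnth y i)%:R * pair_weight x i j.
  by apply: eq_bigr => i _; rewrite mulrC mulr_sumr.
have S2 : S = \sum_i \sum_j (tnth x j != tnth y j)%:R * pair_weight x i j.
  rewrite S1 exchange_big/=; apply: eq_bigr => i _; apply: eq_bigr => j _.
  by rewrite pair_weight_sym.
rewrite mulrDl mul1r [X in X + S + _]S1 S2.
apply: le_trans (lerD (lexx _) (sum_pair_weight_common x y)).
rewrite -!big_split/=; apply: ler_sum => i _.
rewrite -!big_split/=; apply: ler_sum => j _.
have := pair_weight_ge0 x i j.
by do 2 case: eqP => _ /=; lra.
Qed.

End pair_sum.

(** * Concentration of pair sums on the event of small degrees *)

Section concentration.
Context d (T : measurableType d) (R : realType) (mu : probability T R).
Variables (f : T * T -> R) (N : set (T * T)) (c : R).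
Hypothesis mf : measurable_fun [set: T * T] f.
Hypothesis mN : measurable N.
Hypothesis mdiag : measurable [set z : T * T | z.1 = z.2].
Hypothesis f_ge0 : forall z, 0 <= f z.
Hypothesis f_sym : forall p q, f (p, q) = f (q, p).
Hypothesis f_le : forall z, f z <= c * \1_N z.
Hypothesis c_gt0 : 0 < c.

Let mdiag1 : measurable_fun [set: T * T]
  (\1_[set z : T * T | z.1 = z.2] : T * T -> R).
Proof. exact: measurable_indic. Qed.

Lemma measurable_first_occ n (i : 'I_n) :
  measurable_fun [set: n.-tuple T] (fun x => (first_occ x i)%:R : R).
Proof.
pose g (k : 'I_n) (x : n.-tuple T) : R := if (k < i)%N then
  1 - \1_[set z : T * T | z.1 = z.2] (tnth x k, tnth x i) else 1.
rewrite (_ : (fun _ => _) = fun x => \prod_k g k x).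
  apply: measurable_prod => k _; rewrite /g; case: (k < i)%N => //.
  apply: measurable_funB => //.
  apply: (measurableT_comp mdiag1).
  by apply: measurable_fun_pair; exact: measurable_tnth.
apply/funext => x; rewrite /first_occ.
have gE k : g k x = ((k < i)%N ==> (tnth x k != tnth x i))%:R.
  rewrite /g; case: ifP => //= _; rewrite indicE.
  have [e|ne] := eqVneq (tnth x k) (tnth x i).
    by rewrite mem_set//= subrr.
  by rewrite memNset ?subr0//= => /eqP; rewrite (negbTE ne).
case: (boolP [forall k, _]) => [/forallP h|].
  by rewrite big1// => k _; rewrite gE h.
rewrite negb_forall => /existsP[k /negbTE hk].
by rewrite (bigD1 k)//= gE hk mul0r.
Qed.

Lemma measurable_pair_weight n (i j : 'I_n) :
  measurable_fun [set: n.-tuple T] (fun x => pair_weight f x i j).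
Proof.
apply: measurable_funM; last first.
  apply: (measurableT_comp mf).
  by apply: measurable_fun_pair; exact: measurable_tnth.
rewrite (_ : (fun _ => _) =
  fun x => (first_occ x i)%:R * ((first_occ x j)%:R * (i != j)%:R)).
  apply: measurable_funM; first exact: measurable_first_occ.
  by apply: measurable_funM => //; exact: measurable_first_occ.
by apply/funext => x; rewrite -!natrM !mulnb.
Qed.

Lemma measurable_local_sum n (i : 'I_n) :
  measurable_fun [set: n.-tuple T] (fun x => local_sum f x i).
Proof. by apply: measurable_sum => j; exact: measurable_pair_weight. Qed.

Lemma measurable_pair_sum n :
  measurable_fun [set: n.-tuple T] (fun x => pair_sum f x).
Proof.
apply: measurable_funM => //.
by apply: measurable_sum => j; exact: measurable_local_sum.
Qed.

Lemma measurable_pair_sum_le n b :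
  measurable [set x : n.-tuple T | pair_sum f x <= b].
Proof.
rewrite -[X in measurable X]setTI.
rewrite (_ : mkset _ = (fun x => pair_sum f x) @^-1` `]-oo, b]).
  exact: measurable_pair_sum.
by apply/seteqP; split=> x /=; rewrite in_itv/=.
Qed.

Lemma measurable_pair_sum_ge n b :
  measurable [set x : n.-tuple T | b <= pair_sum f x].
Proof.
rewrite -[X in measurable X]setTI.
rewrite (_ : mkset _ = (fun x => pair_sum f x) @^-1` `[b, +oo[).
  exact: measurable_pair_sum.
by apply/seteqP; split=> x /=; rewrite in_itv/= andbT.
Qed.

Definition high_degree n r := [set x : n.-tuple T | exists i, r < degree R N x i].

Lemma measurable_high_degree n r : measurable (@high_degree n r).
Proof.
rewrite (_ : high_degree _ =
  \bigcup_(i in [set: 'I_n]) [set x | r < degree R N x i]).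
  by apply: fin_bigcup_measurable => // i _; exact: measurable_degree_gt.
by apply/seteqP; split=> x /= [i]; [exists i|move=> _ ?; exists i].
Qed.

Lemma local_sum_le_degree n (x : n.-tuple T) i :
  local_sum f x i <= c * degree R N x i.
Proof.
rewrite /local_sum /degree mulr_sumr [leRHS]big_mkcond/=.
apply: ler_sum => j _; rewrite /pair_weight eq_sym.
case: (j != i); last by rewrite !andbF mul0r.
apply: le_trans (f_le _).
by case: (_ && _); rewrite ?mul1r ?mul0r.
Qed.

(** One factor of the square is bounded by [c r], and the sum of the local sums
    counts each pair twice. *)
Lemma sum_local_sum_sqr_le n (x : n.-tuple T) r : ~ high_degree r x ->
  \sum_i local_sum f x i ^+ 2 <= 2 * c * r * pair_sum f x.
Proof.
move=> lo.
rewrite (_ : _ * pair_sum f x = c * r * \sum_i local_sum f x i); last first.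
  by rewrite /pair_sum; field.
rewrite mulr_sumr; apply: ler_sum => i _.
rewrite expr2 ler_wpM2r ?local_sum_ge0//.
apply: (le_trans (local_sum_le_degree x i)).
rewrite ler_pM2l// leNgt; apply/negP => h; apply: lo; by exists i.
Qed.

(** Talagrand's inequality for the weights [th * local_sum] restricted to the
    set [S] of samples with a large pair sum and small degrees.  With
    [K = 2 c r] the exponent obtained at [x] in [S] is at least
    [2 th (pair_sum x - b) - th^2 K pair_sum x]; it is nondecreasing in
    [pair_sum x] since [th K <= 1], and for the value [th = u / (K M)], optimal
    when [b + u = M], it is at least [u^2 / (K M)]. *)
Lemma concentration_convex_distance n (b u M r : R) :
  0 < u -> 0 < r -> u <= M -> b + u <= M ->
  (power mu n [set x | (pair_sum f x <= b)%R] *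
   power mu n ([set x | (b + u <= pair_sum f x)%R] `\` high_degree r) <=
   (expR (- (u ^+ 2 / (8 * c * r * M))))%:E)%E.
Proof.
move=> u0 r0 uM buM.
have M0 : 0 < M by exact: lt_le_trans uM.
set A := [set x | _]; set S := _ `\` _.
have mA : measurable A by exact: measurable_pair_sum_le.
have mS : measurable S.
  by apply: measurableD; [exact: measurable_pair_sum_ge|exact: measurable_high_degree].
pose K := 2 * c * r.
have K0 : 0 < K by rewrite !mulr_gt0.
pose th := u / (K * M).
have th0 : 0 < th by rewrite divr_gt0// mulr_gt0.
have th20 : 0 < 2 * th by rewrite mulr_gt0.
pose e := u ^+ 2 / (K * M).
pose F (x : n.-tuple T) : R := e * \1_S x.
pose a (i : 'I_n) (x : n.-tuple T) : R := th * local_sum f x i * \1_S x.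
have mS1 : measurable_fun [set: n.-tuple T] (\1_S : n.-tuple T -> R).
  exact: measurable_indic.
have mF : measurable_fun [set: n.-tuple T] F by exact: measurable_funM.
have ma i : measurable_fun [set: n.-tuple T] (a i).
  apply: measurable_funM => //; apply: measurable_funM => //.
  exact: measurable_local_sum.
have a0 i x : 0 <= a i x.
  by rewrite mulr_ge0// mulr_ge0 ?(ltW th0)// local_sum_ge0.
have dom x y : A y -> F x <=
    \sum_i (2 * a i x * (tnth x i != tnth y i)%:R - a i x ^+ 2).
  move=> Ay; rewrite /F /a indicE.
  have [/set_mem[/= Sx lo]|_] := boolP (x \in S); last first.
    by rewrite mulr0 big1// => i _; rewrite mulr0 mulr0 mul0r expr0n/= subrr.
  under eq_bigr do rewrite !mulr1.
  rewrite mulr1 sumrB.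
  have -> : \sum_i 2 * (th * local_sum f x i) * (tnth x i != tnth y i)%:R =
      2 * th * \sum_i local_sum f x i * (tnth x i != tnth y i)%:R.
    by rewrite mulr_sumr; apply: eq_bigr => i _; ring.
  have -> : \sum_i (th * local_sum f x i) ^+ 2 =
      th ^+ 2 * \sum_i local_sum f x i ^+ 2.
    by rewrite mulr_sumr; apply: eq_bigr => i _; rewrite exprMn.
  have h1 : 2 * th * (pair_sum f x - b) <=
      2 * th * \sum_i local_sum f x i * (tnth x i != tnth y i)%:R.
    rewrite ler_pM2l//; apply: le_trans (pair_sum_sub_le f_ge0 f_sym x y).
    by rewrite lerD2l lerN2.
  have h2 : th ^+ 2 * \sum_i local_sum f x i ^+ 2 <=
      th ^+ 2 * (K * pair_sum f x).
    by rewrite ler_wpM2l ?sqr_ge0// sum_local_sum_sqr_le.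
  apply: le_trans (lerB h1 h2).
  have eE : e = 2 * th * u - th ^+ 2 * (K * M).
    by rewrite /e /th; field; rewrite !gt_eqF.
  have thK : th * K <= 1.
    have -> : th * K = u / M by rewrite /th; field; rewrite !gt_eqF.
    by rewrite ler_pdivrMr// mul1r.
  have h3 : 0 <= th * (2 - th * K) * (pair_sum f x - (b + u)).
    by rewrite mulr_ge0 ?subr_ge0// mulr_ge0 ?(ltW th0)//; lra.
  have h4 : 0 <= th ^+ 2 * K * (M - (b + u)).
    by rewrite mulr_ge0 ?subr_ge0// mulr_ge0 ?sqr_ge0// ltW.
  rewrite eE; nra.
have := talagrand mu mA mF ma a0 dom.
have int_ge : ((expR (e / 4))%:E * power mu n S <=
    \int[power mu n]_x (expR (F x / 4))%:E)%E.
  have -> : power mu n S = (\int[power mu n]_x (\1_S x)%:E)%E.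
    by rewrite integral_indic// setIT.
  rewrite -ge0_integralZl_EFin ?expR_ge0//; last exact/measurable_EFinP.
  apply: ge0_le_integral => //.
  - by apply/measurable_EFinP; apply: measurable_funM.
  - apply/measurable_EFinP; apply: measurableT_comp => //.
    exact: measurable_funM.
  move=> x _; rewrite -EFinM lee_fin /F indicE.
  by case: (x \in S); rewrite ?mulr1 ?mulr0 ?expR_ge0.
move=> /(le_trans (lee_wpmul2l (measure_ge0 _ A) int_ge)) h.
have -> : u ^+ 2 / (8 * c * r * M) = e / 4.
  by rewrite /e /K; field; rewrite !gt_eqF.
have -> : (power mu n A * power mu n S = (expR (- (e / 4)))%:E *
    (power mu n A * ((expR (e / 4))%:E * power mu n S)))%E.
  have E1 : ((expR (- (e / 4)))%:E * (expR (e / 4))%:E = 1)%E.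
    by rewrite -EFinM -expRD addNr expR0.
  by rewrite -[LHS]mul1e -E1 -muleA [in RHS](muleCA (power mu n A)).
by rewrite -[leRHS]mule1 lee_wpmul2l ?lee_fin ?expR_ge0.
Qed.

End concentration.

(** * Concentration around the median *)

Section median_concentration.
Context d (T : measurableType d) (R : realType) (mu : probability T R).
Variables (f : T * T -> R) (N : set (T * T)) (c : R).
Hypothesis mf : measurable_fun [set: T * T] f.
Hypothesis mN : measurable N.
Hypothesis mdiag : measurable [set z : T * T | z.1 = z.2].
Hypothesis f_ge0 : forall z, 0 <= f z.
Hypothesis f_sym : forall p q, f (p, q) = f (q, p).
Hypothesis f_le : forall z, f z <= c * \1_N z.
Hypothesis c_gt0 : 0 < c.

(** The bound is void if [E >= 1/8]; otherwise large degrees have probability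
    less than [1/8], hence [pair_sum >= m] with small degrees has probability at
    least [3/8], and the three error terms add up to at most
    [2 E + (8/3) E + E <= 8 E]. *)
Lemma median_concentration n (m u r : R) :
  0 <= m -> 0 < u -> 0 < r ->
  ((2^-1)%:E <= power mu n [set x | (pair_sum f x <= m)%R])%E ->
  ((2^-1)%:E <= power mu n [set x | (m <= pair_sum f x)%R])%E ->
  let E := expR (- (u ^+ 2 / (8 * c * r * (u + m)))) in
  (power mu n (high_degree N r) <= E%:E)%E ->
  (power mu n [set x | (u <= `|pair_sum f x - m|)%R] <= (8 * E)%:E)%E.
Proof.
move=> m0 u0 r0 med1 med2 E hE.
pose A b := [set x : n.-tuple T | pair_sum f x <= b].
pose S b := [set x : n.-tuple T | b <= pair_sum f x].
pose H := @high_degree _ T R N n r.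
have mA b : measurable (A b) by exact: measurable_pair_sum_le.
have mS b : measurable (S b) by exact: measurable_pair_sum_ge.
have mH : measurable H by exact: measurable_high_degree.
have mSH b : measurable (S b `\` H) by exact: measurableD.
pose pr (B : set (n.-tuple T)) := fine (power mu n B).
have prE B : measurable B -> power mu n B = (pr B)%:E.
  by move=> mB; rewrite fineK// fin_num_measure.
have pr0 B : 0 <= pr B by rewrite fine_ge0.
have pr_sub B B1 B2 : measurable B -> measurable B1 -> measurable B2 ->
    B `<=` B1 `|` B2 -> pr B <= pr B1 + pr B2.
  move=> mB mB1 mB2 BB; rewrite -lee_fin EFinD -!prE//.
  apply: le_trans (measureU2 _ mB1 mB2).
  by apply: le_measure => //; rewrite inE//; exact: measurableU.
rewrite -/(A m) prE// lee_fin in med1; rewrite -/(S m) prE// lee_fin in med2.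
rewrite -/H prE// lee_fin in hE.
have E0 : 0 < E by exact: expR_gt0.
have key b : b + u <= u + m -> pr (A b) * pr (S (b + u) `\` H) <= E.
  move=> bm; rewrite -lee_fin EFinM -!prE//.
  by apply: (concentration_convex_distance mu mf mN mdiag f_ge0 f_sym f_le c_gt0) => //; lra.
have k1 := key m; rewrite addrC lexx in k1; have {}k1 := k1 isT.
have k2 := key (m - u); rewrite subrK in k2.
have {}k2 : pr (A (m - u)) * pr (S m `\` H) <= E by apply: k2; lra.
have SE b : pr (S b) <= pr (S b `\` H) + pr H.
  by apply: pr_sub => // x Sx; have [Hx|Hx] := pselect (H x); [right|left].
have mD : measurable [set x : n.-tuple T | u <= `|pair_sum f x - m|].
  rewrite (_ : mkset _ = A (m - u) `|` S (u + m)); first exact: measurableU.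
  apply/seteqP; split=> x /=; rewrite ler_normr /A /S /=; first by
    move=> /orP[?|?]; [right|left]; lra.
  by move=> [?|?]; apply/orP; [right|left]; lra.
rewrite prE// lee_fin.
have [E8|E8] := leP (8^-1) E.
  apply: (@le_trans _ _ 1); last lra.
  by rewrite -lee_fin -prE// probability_le1.
have hD : pr [set x : n.-tuple T | u <= `|pair_sum f x - m|] <=
    pr (A (m - u)) + pr (S (u + m)).
  apply: pr_sub => // x /=; rewrite ler_normr /A /S /=.
  by move=> /orP[?|?]; [right|left]; lra.
have s1 := SE m; have s2 := SE (u + m).
have a0 := pr0 (A (m - u)).
have b0 := pr0 (S (u + m) `\` H).
have h1 : 2^-1 * pr (S (u + m) `\` H) <= E.
  by apply: le_trans k1; rewrite ler_wpM2r.
have h2 : pr (A (m - u)) * (3 / 8) <= E.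
  by apply: le_trans k2; rewrite ler_wpM2l//; lra.
lra.
Qed.

Variable p : R.
Hypothesis p_ge0 : 0 <= p.
Hypothesis Np : forall w, (mu [set y | N (w, y)] <= p%:E)%E.

Lemma median_concentration_chernoff n (m u r s : R) : (0 < n)%N ->
  0 <= m -> 0 < u -> 0 < r -> 0 < s ->
  ((2^-1)%:E <= power mu n [set x | (pair_sum f x <= m)%R])%E ->
  ((2^-1)%:E <= power mu n [set x | (m <= pair_sum f x)%R])%E ->
  u ^+ 2 / (8 * c * r * (u + m)) <=
    s * r - ln n%:R - n%:R * p * (expR s - 1) ->
  (power mu n [set x | (u <= `|pair_sum f x - m|)%R] <=
    (8 * expR (- (u ^+ 2 / (8 * c * r * (u + m)))))%:E)%E.
Proof.
move=> n0 m0 u0 r0 s0 med1 med2 hs; apply: median_concentration => //.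
apply: (le_trans (max_degree_tail mN p_ge0 Np n r s0)).
have nE : n%:R = expR (ln n%:R) :> R by rewrite lnK ?posrE ?ltr0n.
rewrite lee_fin [X in X * expR _]nE -expRD ler_expR.
lra.
Qed.

End median_concentration.

(** * Lebesgue measure of Euclidean balls *)

Section lebesgue_rV_geometry.
Context {R : realType}.
Implicit Types (d : nat).

(** This holds without measurability: the integral of a nonnegative function is
    a supremum over the simple functions below it.  It is applied to the
    intersection of a ball with the set in which the points are sampled. *)
Lemma le_lebesgue_rV d (A B : set 'rV[R]_d) :
  A `<=` B -> (lebesgue_rV A <= lebesgue_rV B)%E.
Proof.
elim: d A B => [|d IH] A B AB.
  rewrite /= !diracE lee_fin ler_nat.
  have [/set_mem/AB B0|//] := boolP (0 \in A).
  by rewrite mem_set.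
rewrite /= /pushforward /product_measure1 !ge0_integralTE; last 2 first.
- by move=> a; exact: measure_ge0.
- by move=> a; exact: measure_ge0.
apply: le_ereal_sup => _ [h hA <-]; exists h => // a.
by apply: le_trans (hA a) _; apply: IH => x; rewrite /xsection/= !inE; exact: AB.
Qed.

Lemma lebesgue_rVS d (A : set 'rV[R]_d.+1) :
  (lebesgue_rV A = \int[lebesgue_measure]_a
     lebesgue_rV [set x : 'rV[R]_d | A (cons_rV (a, x))])%E.
Proof.
rewrite /= /pushforward /product_measure1; apply: eq_integral => a _ /=.
by rewrite xsectionE.
Qed.

Lemma ge0_integral_affine (g : R -> \bar R) (a e : R) : 0 < e ->
  measurable_fun [set: R] g -> (forall x, 0 <= g x)%E ->
  (\int[lebesgue_measure]_x g (e^-1 * ((x : R) - a))%R =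
   e%:E * \int[lebesgue_measure]_x g x)%E.
Proof.
move=> e0 mg g0.
pose phi (x : measurableTypeR R) : measurableTypeR R :=
  (e^-1 * ((x : R) - a))%R.
have mphi : measurable_fun [set: measurableTypeR R] phi.
  by apply: measurable_funM => //; exact: measurable_funB.
pose push : {measure set (measurableTypeR R) -> \bar R} :=
  measure_function_pushforward__canonical__measure_function_Measure
    (@lebesgue_measure R) mphi.
have einv : (0 <= e^-1) by rewrite invr_ge0 ltW.
pose nu : {measure set (measurableTypeR R) -> \bar R} :=
  mscale (NngNum einv) push.
have lebE A : measurable A -> lebesgue_measure A = nu A.
  apply: lebesgue_measure_unique => _ [[s t] _ <-] /=.
  rewrite /nu /push /= /mscale/= /pushforward.
  rewrite (_ : phi @^-1` _ = `](e * s + a), (e * t + a)]%classic); last first.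
    apply/seteqP; split=> x /=; rewrite !in_itv/= /phi.
      by rewrite ltr_pdivlMl// ler_pdivrMl// ltrBrDr lerBlDr.
    by rewrite ltr_pdivlMl// ler_pdivrMl// ltrBrDr lerBlDr.
  rewrite !lebesgue_measure_itv/= !lte_fin ltrD2r ltr_pM2l//.
  case: ifP => _; last by rewrite mule0.
  by rewrite -!EFinB -EFinM; congr EFin; field; rewrite gt_eqF.
have -> : (\int[lebesgue_measure]_x g x =
    (e^-1)%:E * \int[lebesgue_measure]_x g (phi x))%E.
  rewrite (@eq_measure_integral _ _ _ setT nu); last by move=> A mA _; exact: lebE.
  rewrite ge0_integral_mscale//=; congr (_ * _)%E.
  by rewrite ge0_integral_pushforward.
by rewrite muleA -EFinM mulfV ?gt_eqF// mul1e.
Qed.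

Lemma lebesgue_rV_affine d (A : set 'rV[R]_d) (a : 'rV[R]_d) (e : R) : 0 < e ->
  measurable A ->
  (lebesgue_rV [set x | A (e^-1 *: (x - a))] = (e ^+ d)%:E * lebesgue_rV A)%E.
Proof.
move=> e0; elim: d A a => [|d IH] A a mA.
  rewrite expr0 mul1e; congr (lebesgue_rV _); apply/seteqP; split=> x /=.
    by rewrite [X in A X](_ : _ = x)//; apply/rowP => -[].
  by rewrite [X in _ -> A X](_ : _ = x)//; apply/rowP => -[].
pose a' : 'rV[R]_d := \row_j a ord0 (lift ord0 j).
pose A' y : set 'rV[R]_d := [set x | A (cons_rV (y, x))].
have mA' y : measurable (A' y).
  have := @measurable_xsection _ _ (measurableTypeR R) 'rV[R]_d
    (@cons_rV R d @^-1` A) y.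
  rewrite xsectionE; apply.
  by rewrite -[X in measurable X]setTI; exact: measurable_cons_rV.
rewrite !lebesgue_rVS.
have E y : lebesgue_rV [set x | A (e^-1 *: (cons_rV (y, x) - a))] =
    ((e ^+ d)%:E * lebesgue_rV (A' (e^-1 * (y - a ord0 ord0))%R))%E.
  rewrite -(IH _ a')//; congr (lebesgue_rV _); apply/seteqP.
  suff E x : e^-1 *: (cons_rV (y, x) - a) =
      cons_rV (e^-1 * (y - a ord0 ord0), e^-1 *: (x - a')).
    by split=> x; rewrite /A'/= E.
  apply/rowP => j; rewrite !mxE.
  by case: (unliftP ord0 j) => [i|] -> /=; rewrite ?liftK ?unlift_none ?mxE.
under eq_integral do rewrite E.
have mF : measurable_fun [set: R] (fun y => lebesgue_rV (A' y)).
  have := @measurable_fun_xsection _ _ (measurableTypeR R) 'rV[R]_d R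
    (@lebesgue_rV R d) (@cons_rV R d @^-1` A).
  rewrite (_ : (fun _ => _) =
    lebesgue_rV (d := d) \o xsection (@cons_rV R d @^-1` A)).
    by apply; rewrite -[X in measurable X]setTI; exact: measurable_cons_rV.
  by apply/funext => w /=; congr (lebesgue_rV _); rewrite xsectionE.
rewrite (ge0_integral_affine
  (g := fun y => (e ^+ d)%:E * lebesgue_rV (A' y))%E)//; last 2 first.
- exact: measurable_funeM.
- by move=> y; rewrite mule_ge0 ?lee_fin ?exprn_ge0// ltW.
rewrite ge0_integralZl_EFin ?exprn_ge0//; last exact: ltW.
by rewrite exprS EFinM muleA.
Qed.

(** Finiteness of the unit ball's volume: without it [kappa], being defined
    through [fine], would be [0]. *)
Lemma lebesgue_rV_cube d :
  (lebesgue_rV [set x : 'rV[R]_d | (forall j, -1 <= x ord0 j <= 1)%R] < +oo)%E.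
Proof.
elim: d => [|d IH].
  by rewrite /= diracE ltry.
rewrite lebesgue_rVS.
set c := lebesgue_rV _ in IH.
have E y : lebesgue_rV [set x : 'rV[R]_d |
      (forall j, -1 <= cons_rV (y, x) ord0 j <= 1)%R] =
    ((\1_(`[-1, 1]%classic : set (measurableTypeR R)) y)%:E * c)%E.
  rewrite indicE; have [|] := boolP (y \in _).
    move=> /set_mem /=; rewrite in_itv/= => y1.
    rewrite mul1e; congr (lebesgue_rV _); apply/seteqP; split=> x /= h j.
      by have := h (lift ord0 j); rewrite cons_rVS.
    by case: (unliftP ord0 j) => [i|] ->; rewrite ?cons_rVS ?cons_rV0.
  move=> y1; rewrite mul0e (_ : mkset _ = set0) ?measure0//.
  apply/seteqP; split=> x //= h; move/negP: y1; apply; apply/mem_set => /=.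
  by have := h ord0; rewrite cons_rV0 in_itv.
under eq_integral do rewrite E.
rewrite ge0_integralZr//=.
- rewrite integral_indic//= setIT lebesgue_measure_itv/= lte_fin gtrN ?ltr01//.
  by rewrite -EFinB lte_mul_pinfty// lee_fin; lra.
- exact/measurable_EFinP/measurable_indic.
- exact: measure_ge0.
Qed.

Lemma abs_coord_le_enorm d (x : 'rV[R]_d) j : `|x ord0 j| <= enorm x.
Proof.
rewrite -sqrtr_sqr ler_wsqrtr// (bigD1 j)//= lerDl.
by apply: sumr_ge0 => i _; exact: sqr_ge0.
Qed.

Lemma kappaE d :
  (kappa d)%:E = lebesgue_rV [set x : 'rV[R]_d | enorm x <= 1] :> \bar R.
Proof.
rewrite fineK// ge0_fin_numE; last exact: measure_ge0.
apply: le_lt_trans (lebesgue_rV_cube d); apply: le_lebesgue_rV => x /= x1 j.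
by rewrite -ler_norml (le_trans (abs_coord_le_enorm x j)).
Qed.

Lemma kappa_ge0 d : 0 <= kappa d :> R.
Proof. by rewrite fine_ge0// measure_ge0. Qed.

Lemma enormN d (x : 'rV[R]_d) : enorm (- x) = enorm x.
Proof. by congr Num.sqrt; apply: eq_bigr => j _; rewrite mxE sqrrN. Qed.

Lemma enormZ d (e : R) (x : 'rV[R]_d) : 0 <= e -> enorm (e *: x) = e * enorm x.
Proof.
move=> e0; rewrite /enorm -{2}(ger0_norm e0) -sqrtr_sqr -sqrtrM ?sqr_ge0//.
by congr Num.sqrt; rewrite mulr_sumr; apply: eq_bigr => j _; rewrite mxE exprMn.
Qed.

Lemma measurable_enorm d : measurable_fun [set: 'rV[R]_d] (@enorm R d).
Proof.
apply: (@measurableT_comp _ _ _ _ _ _ (@Num.sqrt R)).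
  by apply: continuous_measurable_fun; exact: sqrt_continuous.
apply: measurable_sum => j; apply: measurable_funX; exact: measurable_coord.
Qed.

Lemma lebesgue_rV_ball d (a : 'rV[R]_d) (e : R) : 0 < e ->
  lebesgue_rV [set x | enorm (a - x) <= e] = (kappa d * e ^+ d)%:E.
Proof.
move=> e0; rewrite mulrC EFinM kappaE -(lebesgue_rV_affine a e0); last first.
  rewrite -[X in measurable X]setTI.
  rewrite (_ : mkset _ = (@enorm R d) @^-1` `]-oo, 1]).
    exact: measurable_enorm.
  by apply/seteqP; split=> x /=; rewrite in_itv/=.
congr (lebesgue_rV _); apply/seteqP.
suff E x : (enorm (e^-1 *: (x - a)) <= 1) = (enorm (a - x) <= e).
  by split=> x /=; rewrite E.
have ei : 0 <= e^-1 by rewrite invr_ge0 ltW.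
by rewrite enormZ// ler_pdivrMl// mulr1 -enormN opprB.
Qed.

End lebesgue_rV_geometry.

(** * The edge-length functional *)

Section edge_functional.
Context {R : realType} (d : nat) (tau delta : R).

Definition edge_weight (z : 'rV[R]_d * 'rV[R]_d) : R :=
  (enorm (z.1 - z.2) <= delta)%R%:R * enorm (z.1 - z.2) `^ tau.

Definition neighbours : set ('rV[R]_d * 'rV[R]_d) :=
  [set z | enorm (z.1 - z.2) <= delta].

Lemma fsbig_fintype (I : finType) (P : pred I) (F : I -> R) :
  \sum_(i \in [set i | P i]) F i = \sum_(i | P i) F i.
Proof.
rewrite fsbig_mkcond (_ : [set: I] = [set` index_enum I]); last first.
  by apply/seteqP; split=> i //= _; rewrite mem_index_enum.
rewrite -fsbig_seq ?index_enum_uniq// [RHS]big_mkcond/=.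
apply: eq_bigr => i _; rewrite /patch.
have [Pi|Pi] := boolP (P i); first by rewrite mem_set.
by rewrite memNset//=; apply/negP.
Qed.

Lemma edge_length_sumE n (x : n.-tuple 'rV[R]_d) :
  edge_length_sum tau delta [set tnth x i | i in [set: 'I_n]] =
  pair_sum edge_weight x.
Proof.
rewrite /edge_length_sum /pair_sum; congr (_ * _).
pose Q (z : 'I_n * 'I_n) := [&& first_occ x z.1, first_occ x z.2 & z.1 != z.2].
pose h (z : 'I_n * 'I_n) := (tnth x z.1, tnth x z.2).
have -> : [set p : 'rV[R]_d * 'rV[R]_d |
    [/\ [set tnth x i | i in [set: 'I_n]] p.1,
        [set tnth x i | i in [set: 'I_n]] p.2 & p.1 <> p.2]] =
    h @` [set z | Q z].
  apply/seteqP; split=> [[a b] /= [[i _ <-] [j _ <-] ij]|_ [[i j] /= + <-] /=].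
    have [k [fk xk]] := first_occ_exists x i.
    have [l [fl xl]] := first_occ_exists x j.
    exists (k, l); rewrite /h /Q/= ?xk ?xl// fk fl/=.
    by apply/eqP => kl; apply: ij; rewrite -xk -xl kl.
  rewrite /Q/= => /and3P[fi fj ij]; split; [by exists i|by exists j|].
  by move=> xij; move: ij; rewrite (first_occ_inj fi fj xij) eqxx.
rewrite fsbig_image; last first.
  move=> [i j] [k l] /set_mem/and3P[/= fi fj _] /set_mem/and3P[/= fk fl _].
  by move=> [/(first_occ_inj fi fk) -> /(first_occ_inj fj fl) ->].
rewrite fsbig_fintype /local_sum pair_bigA/= big_mkcond/=.
by apply: eq_bigr => z _; rewrite /pair_weight /Q; case: ifP; rewrite ?mul1r ?mul0r.
Qed.

Let mg : measurable_fun [set: 'rV[R]_d * 'rV[R]_d] (fun z => enorm (z.1 - z.2)).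
Proof.
apply: (measurableT_comp (@measurable_enorm R d)).
apply: measurable_fun_rV => j.
rewrite (_ : (fun _ => _) = fun z : 'rV[R]_d * 'rV[R]_d => z.1 ord0 j - z.2 ord0 j).
  apply: measurable_funB.
    exact: (measurableT_comp (measurable_coord j)).
  exact: (measurableT_comp (measurable_coord j)).
by apply/funext => z; rewrite !mxE.
Qed.

Lemma measurable_neighbours : measurable neighbours.
Proof.
rewrite -[X in measurable X]setTI.
rewrite (_ : neighbours =
  (fun z : 'rV[R]_d * 'rV[R]_d => enorm (z.1 - z.2)) @^-1` `]-oo, delta]).
  exact: mg.
by apply/seteqP; split=> x /=; rewrite in_itv/=.
Qed.

Lemma measurable_diagonal_rV :
  measurable [set z : 'rV[R]_d * 'rV[R]_d | z.1 = z.2].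
Proof.
rewrite -[X in measurable X]setTI.
rewrite (_ : mkset _ =
  (fun z : 'rV[R]_d * 'rV[R]_d => enorm (z.1 - z.2)) @^-1` [set 0]).
  exact: mg.
apply/seteqP; split=> [[a b] /= ->|[a b] /= ab0].
  rewrite subrr /enorm big1 ?sqrtr0// => j _; by rewrite mxE expr0n.
apply/rowP => j; apply/eqP; rewrite -subr_eq0 -normr_le0 -ab0.
by apply: le_trans (abs_coord_le_enorm _ j); rewrite !mxE.
Qed.

Lemma edge_weightE : edge_weight =
  (fun z => \1_neighbours z * enorm (z.1 - z.2) `^ tau).
Proof.
apply/funext => z; rewrite /edge_weight indicE; congr (_%:R * _).
by congr nat_of_bool; apply/idP/idP => [h|/set_mem//]; apply/mem_set.
Qed.

Lemma measurable_edge_weight : measurable_fun [set: _] edge_weight.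
Proof.
rewrite edge_weightE; apply: measurable_funM.
  exact: measurable_indic measurable_neighbours.
exact: (measurableT_comp (measurable_powR tau)).
Qed.

Lemma edge_weight_ge0 z : 0 <= edge_weight z.
Proof. by rewrite mulr_ge0// powR_ge0. Qed.

Lemma edge_weight_sym p q : edge_weight (p, q) = edge_weight (q, p).
Proof. by rewrite /edge_weight/= -opprB enormN. Qed.

Lemma edge_weight_le z : 0 <= tau -> 0 < delta ->
  edge_weight z <= delta `^ tau * \1_neighbours z.
Proof.
move=> tau0 del0; rewrite edge_weightE mulrC indicE.
have [/set_mem/= zN|_] := boolP (z \in neighbours); last by rewrite !mulr0.
by rewrite !mulr1 ge0_ler_powR ?nnegrE ?sqrtr_ge0// ltW.
Qed.

End edge_functional.

(** * Optimising the exponent *)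

Section exponents.
Context {R : realType}.

Lemma expR1_le3 : expR (1 : R) <= 3.
Proof.
have h : expR (6^-1 : R) <= 6 / 5.
  have := expR_ge1Dx (- 6^-1 : R); rewrite expRN => h.
  rewrite -[leLHS]invrK (_ : 6 / 5 = (5 / 6)^-1); last by rewrite invf_div.
  rewrite lef_pV2 ?posrE ?invr_gt0 ?expR_gt0//; lra.
have -> : (1 : R) = 6%:R * 6^-1 by rewrite mulfV.
rewrite expRM_natl; apply: (@le_trans _ _ ((6 / 5) ^+ 6)).
  by rewrite lerXn2r ?nnegrE ?expR_ge0//; lra.
lra.
Qed.

(** The case [inf S = 0] is covered by the convention [B / 0 = 0], which makes the
    conclusion trivial. *)
Lemma le_expR_inf (S : set R) (B p : R) : S !=set0 -> (forall x, S x -> 0 < x) ->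
  0 < B -> (forall x, S x -> p <= 8 * expR (- (B / x))) ->
  p <= 8 * expR (- (B / inf S)).
Proof.
move=> S0 Sgt0 B0 pS; have [x0 Sx0] := S0.
have infS0 : 0 <= inf S by apply: lb_le_inf => // x /Sgt0/ltW.
move: infS0; rewrite le_eqVlt => /predU1P[<-|infS0].
  rewrite invr0 mulr0 oppr0 expR0 mulr1; apply: le_trans (pS _ Sx0) _.
  have : expR (- (B / x0)) <= 1.
    by rewrite expR_le1 oppr_le0 divr_ge0// ltW// Sgt0.
  lra.
rewrite leNgt; apply/negP => hp.
have p0 : 0 < p / 8 by rewrite divr_gt0// (lt_trans _ hp)// mulr_gt0 ?expR_gt0.
pose q := - ln (p / 8).
have qE : p = 8 * expR (- q) by rewrite /q opprK lnK ?posrE//; field.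
have Bq x : S x -> B / x <= q.
  by move=> /pS; rewrite qE ler_pM2l// ler_expR lerN2.
have q0 : 0 < q by apply: lt_le_trans (Bq _ Sx0); rewrite divr_gt0// Sgt0.
have : B / q <= inf S.
  apply: lb_le_inf => // x Sx; rewrite ler_pdivrMr// mulrC -ler_pdivrMr ?Sgt0//.
  exact: Bq.
rewrite ler_pdivrMr// mulrC -ler_pdivrMr// => Bi.
by move: hp; rewrite qE ltr_pM2l// ltr_expR ltrN2 ltNge Bi.
Qed.

(** The convex distance and Chernoff exponents agree at [r = lam * x]: this
    equation in [x] is quadratic, and [x] is its positive root. *)
Lemma chernoff_root (lam s l c M u : R) :
  0 < lam -> 0 < s -> 0 < l -> 0 < c -> 0 < M -> 0 < u ->
  let a := l / (2 * lam * s) in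
  let x := a + Num.sqrt (u ^+ 2 / (8 * lam ^+ 2 * c * M * s) + a ^+ 2) in
  0 < x /\ u ^+ 2 / (8 * c * (lam * x) * M) = s * (lam * x) - l.
Proof.
move=> lam0 s0 l0 c0 M0 u0 a x.
have a0 : 0 < a by rewrite divr_gt0// !mulr_gt0.
have b0 : 0 < u ^+ 2 / (8 * lam ^+ 2 * c * M * s).
  by rewrite divr_gt0 ?exprn_gt0// !mulr_gt0// exprn_gt0.
have x0 : 0 < x by rewrite /x ltr_wpDr// sqrtr_ge0.
split=> //.
have xa : (x - a) ^+ 2 = u ^+ 2 / (8 * lam ^+ 2 * c * M * s) + a ^+ 2.
  by rewrite /x addrC addKr sqr_sqrtr// addr_ge0 ?sqr_ge0// ltW.
have : x ^+ 2 - 2 * a * x = u ^+ 2 / (8 * lam ^+ 2 * c * M * s).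
  by apply: (addIr (a ^+ 2)); rewrite -xa; ring.
have lE : l = 2 * lam * s * a by rewrite /a; field; rewrite !gt_eqF.
move=> xx; rewrite lE.
have -> : s * (lam * x) - 2 * lam * s * a = s * lam * (x ^+ 2 - 2 * a * x) / x.
  by field; rewrite gt_eqF.
by rewrite xx; field; rewrite !gt_eqF.
Qed.

(** The two terms of the minimum correspond to which summand of
    [l + u / Num.sqrt (8 * c * M)] is the larger one; replacing the sum by twice
    that summand loses a factor at most [2]. *)
Lemma min_le_exponent (l c M u : R) : 0 < l -> 0 < c -> 0 < M -> 0 < u ->
  Num.min (u ^+ 2 / (16 * c * l * M)) (u / (4 * Num.sqrt (2 * c) * Num.sqrt M))
    <= u ^+ 2 / (8 * c * (l + u / Num.sqrt (8 * c * M)) * M).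
Proof.
move=> l0 c0 M0 u0; set q := Num.sqrt (8 * c * M); set r := l + u / q.
have q0 : 0 < q by rewrite sqrtr_gt0 !mulr_gt0.
have q2 : q ^+ 2 = 8 * c * M by rewrite sqr_sqrtr// !mulr_ge0// ltW.
have v0 : 0 < u / q by rewrite divr_gt0.
have r0 : 0 < r by rewrite addr_gt0.
have qE : 4 * Num.sqrt (2 * c) * Num.sqrt M = 2 * q.
  have c20 : 0 <= 2 * c by rewrite mulr_ge0// ltW.
  rewrite /q (_ : 8 * c * M = 2 ^+ 2 * (2 * c * M)); last by ring.
  by rewrite (sqrtrM _ (sqr_ge0 2)) (sqrtrM _ c20) sqrtr_sqr ger0_norm//; ring.
rewrite {}qE ge_min.
have rE : 8 * c * r * M = q ^+ 2 * r by rewrite q2; ring.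
have lE : 16 * c * l * M = q ^+ 2 * (2 * l) by rewrite q2; ring.
rewrite rE lE.
have q20 : 0 < q ^+ 2 by rewrite exprn_gt0.
have u20 : 0 < u ^+ 2 by rewrite exprn_gt0.
have inv_le y : 0 < y -> r <= y ->
    u ^+ 2 / (q ^+ 2 * y) <= u ^+ 2 / (q ^+ 2 * r).
  move=> y0 ry; rewrite ler_pM2l// lef_pV2 ?posrE ?ler_pM2l//.
    exact: mulr_gt0.
  exact: mulr_gt0.
have [vl|vl] := leP (u / q) l; apply/orP; [left|right].
  by apply: inv_le; rewrite /r; lra.
have -> : u / (2 * q) = u ^+ 2 / (q ^+ 2 * (2 * (u / q))).
  by field; rewrite !gt_eqF.
by apply: inv_le; rewrite /r; lra.
Qed.

End exponents.

(** * Concentration of the edge-length functional *)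

Section gilbert_graph.
Context {R : realType} (d n : nat) (W : set 'rV[R]_d) (tau delta : R).
Context d0 (Om : measurableType d0) (P : probability Om R)
  (X : 'I_n -> {RV P >-> 'rV[R]_d}) (m : R).
Hypothesis Wvolume : lebesgue_rV W = 1%E.
Hypothesis n_gt1 : (1 < n)%N.
Hypothesis tau_ge0 : 0 <= tau.
Hypothesis delta_gt0 : 0 < delta.
Hypothesis Xindep : mutually_independent X.
Hypothesis Xunif : forall i, uniformly_distributed (X i) W.

Let L w := edge_length_sum tau delta [set X i w | i in [set: 'I_n]].

Hypothesis Lmedian : is_median P L m.

Let LE w : L w = pair_sum (@edge_weight R d tau delta) [tuple X i w | i < n].
Proof.
rewrite -edge_length_sumE; congr edge_length_sum.
by apply/seteqP; split=> _ [i _ <-]; exists i => //; rewrite tnth_mktuple.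
Qed.

Lemma median_ge0 : 0 <= m.
Proof.
rewrite leNgt; apply/negP => m0; have [+ _] := Lmedian.
rewrite (_ : mkset _ = set0) ?measure0 ?lee_fin.
  by apply/negP; rewrite -ltNge invr_gt0.
apply/seteqP; split=> w //=; rewrite LE => Lm.
have := le_trans
  (pair_sum_ge0 (@edge_weight_ge0 R d tau delta) [tuple X i w | i < n]) Lm.
by rewrite leNgt m0.
Qed.

Let i0 : 'I_n := Ordinal (ltnW n_gt1).
Let mu : probability 'rV[R]_d R := distribution P (X i0).

Let muE B : measurable B -> mu B = lebesgue_rV (W `&` B).
Proof.
move=> mB; apply: etrans (Xunif i0 mB) _.
by rewrite Wvolume/= invr1 mule1.
Qed.

Let lawX i B : measurable B -> P (X i @^-1` B) = mu B.
Proof.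
move=> mB; rewrite muE//; apply: etrans (Xunif i mB) _.
by rewrite Wvolume/= invr1 mule1.
Qed.

Let mu_ball w :
  (mu [set y | neighbours delta (w, y)] <= (kappa d * delta ^+ d)%:E)%E.
Proof.
rewrite muE; last first.
  rewrite -[X in measurable X]xsectionE; apply: measurable_xsection.
  exact: measurable_neighbours.
by rewrite -(lebesgue_rV_ball w)//; apply: le_lebesgue_rV => y [].
Qed.

Let transfer (Q : R -> Prop) :
  measurable [set x : n.-tuple 'rV[R]_d |
    Q (pair_sum (@edge_weight R d tau delta) x)] ->
  P [set w | Q (L w)] =
  power mu n [set x | Q (pair_sum (@edge_weight R d tau delta) x)].
Proof.
move=> mQ; rewrite -(power_law Xindep lawX mQ).
by congr (P _); apply/seteqP; split=> w /=; rewrite LE.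
Qed.

Let measurable_deviation (u : R) : measurable [set x : n.-tuple 'rV[R]_d |
  u <= `|pair_sum (@edge_weight R d tau delta) x - m|].
Proof.
rewrite -[X in measurable X]setTI.
rewrite (_ : mkset _ =
  (fun x => `|pair_sum (@edge_weight R d tau delta) x - m|) @^-1` `[u, +oo[).
  apply: (measurableT_comp (@normr_measurable R setT)) => //.
  apply: measurable_funB => //.
  exact: (measurable_pair_sum (measurable_edge_weight _ _)
    (@measurable_diagonal_rV R d)).
by apply/seteqP; split=> x /=; rewrite in_itv/= andbT.
Qed.

Let deviationE (u : R) : P [set w | u <= `|L w - m|] =
  power mu n [set x | u <= `|pair_sum (@edge_weight R d tau delta) x - m|].
Proof. exact: (transfer (Q := fun y => u <= `|y - m|)). Qed.

Let lam := n%:R * kappa d * delta ^+ d.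
Let c := delta `^ tau.
Let l s := ln n%:R + lam * (expR s - 1).

Lemma gilbert_graph_concentration (u r s : R) : 0 < u -> 0 < r -> 0 < s ->
  u ^+ 2 / (8 * c * r * (u + m)) <= s * r - l s ->
  (P [set w | (u <= `|L w - m|)%R] <=
    (8 * expR (- (u ^+ 2 / (8 * c * r * (u + m)))))%:E)%E.
Proof.
move=> u0 r0 s0 hs.
have mf := @measurable_edge_weight R d tau delta.
have mN := @measurable_neighbours R d delta.
have mdiag := @measurable_diagonal_rV R d.
have f0 := @edge_weight_ge0 R d tau delta.
have [med1 med2] := Lmedian.
have mL := measurable_pair_sum mf mdiag (n := n).
rewrite (transfer (Q := fun y => y <= m)) in med1; last exact: measurable_pair_sum_le.
rewrite (transfer (Q := fun y => m <= y)) in med2; last exact: measurable_pair_sum_ge.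
rewrite deviationE.
apply: (median_concentration_chernoff mf mN mdiag f0 (@edge_weight_sym R d tau delta)
  (fun z => edge_weight_le z tau_ge0 delta_gt0) (powR_gt0 _ delta_gt0) _ mu_ball
  (ltnW n_gt1) median_ge0 u0 r0 s0 med1 med2).
  by rewrite mulr_ge0 ?kappa_ge0// exprn_ge0// ltW.
by apply: le_trans hs _; rewrite /l /lam; lra.
Qed.

Let ln_gt0' : 0 < ln n%:R :> R.
Proof. by rewrite ln_gt0// ltr1n. Qed.

Let lam_ge0 : 0 <= lam.
Proof. by rewrite !mulr_ge0 ?kappa_ge0 ?exprn_ge0// ltW. Qed.

Let M_gt0 (u : R) : 0 < u -> 0 < u + m.
Proof. by move=> u0; rewrite ltr_wpDr// median_ge0. Qed.

Let cE : n%:R * kappa d * delta `^ (d%:R + tau) = lam * c.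
Proof.
rewrite powRD; last by apply/implyP => _; rewrite gt_eqF.
by rewrite powR_mulrn 1?ltW// mulrA.
Qed.

Lemma gilbert_graph_concentration_xstar (u : R) : 0 < u ->
  (P [set w | (u <= `|L w - m|)%R] <=
    (8 * expR (- (u ^+ 2 / (8 * n%:R * kappa d * delta `^ (d%:R + tau)
                            * xstar d tau delta n m u * (u + m)))))%:E)%E.
Proof.
move=> u0; have M0 := M_gt0 u0.
have -> : 8 * n%:R * kappa d * delta `^ (d%:R + tau) = 8 * (lam * c).
  by rewrite -cE; ring.
move: lam_ge0; rewrite le_eqVlt => /predU1P[lam0|lam0].
  rewrite -lam0 !(mul0r, mulr0) invr0 mulr0 oppr0 expR0 mulr1.
  by rewrite deviationE (le_trans (probability_le1 _ _))// lee_fin ler1n.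
have c0 : 0 < c by rewrite powR_gt0.
have l0 s : 0 < s -> 0 < l s.
  move=> s0; rewrite ltr_wpDr// mulr_ge0// subr_ge0 -expR0 ler_expR ltW//.
pose a s := l s / (2 * lam * s).
pose x s := a s + Num.sqrt (u ^+ 2 / (8 * lam ^+ 2 * c * (u + m) * s) + a s ^+ 2).
have -> : xstar d tau delta n m u = inf [set x s | s in [set s | 0 < s]].
  rewrite /xstar; congr inf; apply: eq_imagel => s _.
  have cE2 : delta `^ (2 * d%:R + tau) = (delta ^+ d) ^+ 2 * c.
    rewrite powRD; last by apply/implyP => _; rewrite gt_eqF.
    by rewrite -natrM powR_mulrn 1?ltW// mulnC exprM.
  rewrite /x /a /l /lam; congr (_ / _ + Num.sqrt (_ / _ + (_ / _) ^+ 2)).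
  - by ring.
  - by rewrite cE2; ring.
  - by ring.
set S := [set x s | s in _].
pose B := u ^+ 2 / (8 * (lam * c) * (u + m)).
have BE y : u ^+ 2 / (8 * (lam * c) * y * (u + m)) = B / y.
  by rewrite /B -[RHS]mulrA -invfM; congr (_ / _); ring.
rewrite BE deviationE -[leLHS]fineK ?fin_num_measure// lee_fin.
apply: le_expR_inf.
- by exists (x 1), 1 => //=.
- move=> _ [s /= s0 <-].
  by have [] := chernoff_root lam0 s0 (l0 _ s0) c0 M0 u0.
- apply: divr_gt0; first exact: exprn_gt0.
  by apply: mulr_gt0 M0; apply: mulr_gt0 => //; exact: mulr_gt0.
move=> _ [s /= s0 <-].
have [x0 xE] := chernoff_root lam0 s0 (l0 _ s0) c0 M0 u0.
rewrite -lee_fin fineK ?fin_num_measure// -deviationE.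
have r0 : 0 < lam * x s by rewrite mulr_gt0.
have := gilbert_graph_concentration u0 r0 s0.
rewrite xE lexx => /(_ isT).
rewrite -xE (_ : 8 * c * (lam * _) * (u + m) = 8 * (lam * c) * x s * (u + m)).
  by rewrite BE.
by rewrite /x /a; ring.
Qed.

Lemma gilbert_graph_concentration_explicit (u : R) : 0 < u ->
  (P [set w | (u <= `|L w - m|)%R] <=
    (8 * expR (- Num.min
      (u ^+ 2 / (16 * (ln n%:R * delta `^ tau
                       + 2 * n%:R * kappa d * delta `^ (d%:R + tau)) * (u + m)))
      (u / (4 * Num.sqrt (2 * delta `^ tau) * Num.sqrt (u + m)))))%:E)%E.
Proof.
move=> u0; have M0 := M_gt0 u0.
set C := 16 * (_ + _).
have c0 : 0 < c by rewrite powR_gt0.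
pose l1 := ln n%:R + 2 * lam.
have l10 : 0 < l1 by rewrite ltr_wpDr// mulr_ge0.
pose q := Num.sqrt (8 * c * (u + m)).
have q0 : 0 < q by rewrite sqrtr_gt0 !mulr_gt0.
pose r := l1 + u / q.
have v0 : 0 < u / q by rewrite divr_gt0.
have r0 : 0 < r by rewrite addr_gt0.
have hs : u ^+ 2 / (8 * c * r * (u + m)) <= 1 * r - l 1.
  apply: (@le_trans _ _ (u / q)).
    have -> : 8 * c * r * (u + m) = q ^+ 2 * r.
      rewrite sqr_sqrtr; first by ring.
      by rewrite !mulr_ge0// ltW.
    have -> : u ^+ 2 / (q ^+ 2 * r) = u / q * (u / q / r).
      by field; rewrite !gt_eqF.
    by rewrite ger_pMr// ler_pdivrMr// mul1r /r lerDr ltW.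
  have : lam * (expR 1 - 1) <= lam * 2.
    by rewrite ler_wpM2l//; have := @expR1_le3 R; lra.
  by rewrite /r /l1 /l; lra.
apply: le_trans (gilbert_graph_concentration u0 r0 ltr01 hs) _.
rewrite lee_fin ler_pM2l// ler_expR lerN2.
have := min_le_exponent l10 c0 M0 u0.
have -> : 16 * c * l1 * (u + m) = C * (u + m).
  rewrite /C -!mulrA [X in 2 * X](_ : _ = lam * c); last by rewrite -cE -!mulrA.
  by rewrite /l1 -/c; ring.
by [].
Qed.

End gilbert_graph.

Theorem theorem6p6 (R : realType) (d : nat) (hd : (1 <= d)%N)
  (W : set 'rV[R]_d) (Wcompact : compact W) (Wconvex : convex_set W)
  (Wvolume : lebesgue_rV W = 1%E)
  (delta : nat -> R) (delta_gt0 : forall k, 0 < delta k)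
  (delta_cvg0 : delta k @[k --> \oo] --> 0)
  (n : nat) (hn : (2 <= n)%N)
  (d0 : measure_display) (Om : measurableType d0) (P : probability Om R)
  (X : 'I_n -> {RV P >-> 'rV[R]_d})
  (Xindep : mutually_independent X)
  (Xunif : forall i, uniformly_distributed (X i) W)
  (tau : R) (tau_ge0 : 0 <= tau) (m : R) :
  let xi w := [set X i w | i in [set: 'I_n]] in
  let L w := edge_length_sum tau (delta n) (xi w) in
  is_median P L m ->
  forall u : R, 0 < u ->
    (P [set w | (u <= `|L w - m|)%R] <=
       (8 * expR (- (u ^+ 2 / (8 * n%:R * kappa d * delta n `^ (d%:R + tau)
                               * xstar d tau (delta n) n m u * (u + m)))))%:E)%E
    /\
    (let C := 16 * (ln n%:R * delta n `^ tau
                    + 2 * n%:R * kappa d * delta n `^ (d%:R + tau)) in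
     let D := 4 * Num.sqrt (2 * delta n `^ tau) in
     (P [set w | (u <= `|L w - m|)%R] <=
       (8 * expR (- Num.min (u ^+ 2 / (C * (u + m)))
                            (u / (D * Num.sqrt (u + m)))))%:E)%E).
Proof.
move=> xi L Lmed u u0; split.
  exact: (gilbert_graph_concentration_xstar Wvolume hn tau_ge0 (delta_gt0 n)
    Xindep Xunif Lmed u0).
exact: (gilbert_graph_concentration_explicit Wvolume hn tau_ge0 (delta_gt0 n)
  Xindep Xunif Lmed u0).
Qed.
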